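(* Let $\mathcal R$ be a classical Cartan domain of the first, second or third type, or a Cartesian product of such domains, and let $m\ge 2$. Then every weak $m$-extremal $f:\mathbb D\to\mathcal R$ is an $m$-extremal.
   Context: $\mathbb D$ is the open unit disc in $\mathbb C$. Classical Cartan domains: type I, $\mathcal R_I^{n,m}=\{z\in\mathbb C^{n\times m}: 1-zz^*>0\}$; type II, $\mathcal R_{II}^n$, the symmetric matrices $z\in\mathbb C^{n\times n}$ with $1-zz^*>0$; type III, $\mathcal R_{III}^n$, the skew-symmetric matrices $z\in\mathbb C^{n\times n}$ with $1-zz^*>0$. These domains and their Cartesian products are bounded, convex and balanced, and their groups of holomorphic automorphisms act transitively. Let $D$ be a domain in $\mathbb C^n$, $m\ge2$, $\lambda_1,\dots,\lambda_m\in\mathbb D$ pairwise distinct and $z_1,\dots,z_m\in D$. The interpolation data $\lambda_j\mapsto z_j$, $j=1,\dots,m$, are extremally solvable if there is a holomorphic $h:\mathbb D\to D$ with $h(\lambda_j)=z_j$ for all $j$, and there is no map $g$ holomorphic on a neighbourhood of $\overline{\mathbb D}$ with image in $D$ such that $g(\lambda_j)=z_j$ for all $j$. A holomorphic $f:\mathbb D\to D$ is a weak $m$-extremal with respect to $\lambda_1,\dots,\lambda_m$ if the data $\lambda_j\mapsto f(\lambda_j)$, $j=1,\dots,m$, are extremally solvable; it is a weak $m$-extremal if this holds for some choice of $m$ pairwise distinct points of $\mathbb D$; it is an $m$-extremal if this holds for every choice of $m$ pairwise distinct points of $\mathbb D$. *)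

(* Defs.v *)
From HB Require Import structures.
From mathcomp Require Import all_boot all_order all_algebra complex.
From mathcomp Require Import all_classical all_reals all_analysis.

Set Implicit Arguments.
Unset Strict Implicit.
Unset Printing Implicit Defensive.

Import Order.TTheory GRing.Theory Num.Theory.
Import numFieldNormedType.Exports.

Local Open Scope classical_set_scope.
Local Open Scope complex_scope.
Local Open Scope ring_scope.
Local Open Scope sesquilinear_scope.

(* The complex numbers are R[i] for R : realType.  The regular module R[i]^o  *)
(* is used wherever their topology matters, because the library attaches the  *)
(* normed module structure to R[i]^o and not to R[i].                         *)

Section extremals.
Context {R : realType}.

Definition disc : set R[i]^o := [set z | `|z| < 1].

Definition closed_disc : set R[i]^o := [set z | `|z| <= 1].

(* The scalars being complex, derivability in the direction 1 is complex      *)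
(* differentiability.  Functions are total: their values off U play no role   *)
(* when U is open.                                                            *)
Definition holomorphic_on {V : normedModType R[i]}
    (U : set R[i]^o) (f : R[i]^o -> V) : Prop :=
  forall z, U z -> derivable f z 1.

(* D is an arbitrary subset of a normed space rather than an open subset of   *)
(* some C^n, so that a domain in a linear subspace of V (such as a set of     *)
(* symmetric matrices) needs no choice of coordinates.  For V of finite       *)
(* dimension, a map with values in a subspace of V is holomorphic into the    *)
(* subspace if and only if it is holomorphic into V.                          *)
Definition holomorphic_map {V : normedModType R[i]}
    (U : set R[i]^o) (D : set V) (f : R[i]^o -> V) : Prop :=
  holomorphic_on U f /\ (forall z, U z -> D (f z)).

Definition distinct_nodes {m : nat} (lam : 'I_m -> R[i]^o) : Prop :=
  injective lam /\ (forall j, disc (lam j)).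

Definition extremally_solvable {V : normedModType R[i]} (D : set V)
    {m : nat} (lam : 'I_m -> R[i]^o) (z : 'I_m -> V) : Prop :=
  (exists h : R[i]^o -> V,
     holomorphic_map disc D h /\ (forall j, h (lam j) = z j)) /\
  ~ (exists (U : set R[i]^o) (g : R[i]^o -> V),
       [/\ open U, closed_disc `<=` U, holomorphic_map U D g
         & forall j, g (lam j) = z j]).

Definition weak_extremal_wrt {V : normedModType R[i]} (D : set V)
    {m : nat} (lam : 'I_m -> R[i]^o) (f : R[i]^o -> V) : Prop :=
  extremally_solvable D lam (fun j => f (lam j)).

Definition weak_m_extremal {V : normedModType R[i]} (D : set V) (m : nat)
    (f : R[i]^o -> V) : Prop :=
  holomorphic_map disc D f /\
  exists lam : 'I_m -> R[i]^o,
    distinct_nodes lam /\ weak_extremal_wrt D lam f.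

Definition m_extremal {V : normedModType R[i]} (D : set V) (m : nat)
    (f : R[i]^o -> V) : Prop :=
  holomorphic_map disc D f /\
  forall lam : 'I_m -> R[i]^o,
    distinct_nodes lam -> weak_extremal_wrt D lam f.

(* Hermitian symmetry need not be required separately: 0 < x in R[i] forces x *)
(* to be real, and a complex matrix with real quadratic form is Hermitian.    *)
Definition posdefmx {n : nat} (A : 'M[R[i]]_n) : Prop :=
  forall v : 'cV[R[i]]_n, v != 0 -> 0 < (v ^t* *m A *m v) 0 0.

Definition matrix_ball {n m : nat} : set 'M[R[i]]_(n, m) :=
  [set z | posdefmx (1%:M - z *m z ^t*)].

End extremals.

Inductive cartan_shape : Type :=
| CartanI of nat & nat
| CartanII of nat
| CartanIII of nat
| CartanProd of cartan_shape & cartan_shape.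

(* Matrices with no rows or no columns are excluded. *)
Fixpoint pos_sizes (s : cartan_shape) : bool :=
  match s with
  | CartanI n m => (0 < n)%N && (0 < m)%N
  | CartanII n => (0 < n)%N
  | CartanIII n => (0 < n)%N
  | CartanProd s1 s2 => pos_sizes s1 && pos_sizes s2
  end.

Fixpoint cartan_space (R : realType) (s : cartan_shape) : normedModType R[i] :=
  match s with
  | CartanI n m => 'M[R[i]]_(n, m)
  | CartanII n => 'M[R[i]]_n
  | CartanIII n => 'M[R[i]]_n
  | CartanProd s1 s2 => (cartan_space R s1 * cartan_space R s2)%type
  end.

Fixpoint cartan_domain (R : realType) (s : cartan_shape) :
    set (cartan_space R s) :=
  match s return set (cartan_space R s) with
  | CartanI n m => @matrix_ball R n m
  | CartanII n => [set z : 'M[R[i]]_n | z^T = z /\ matrix_ball z]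
  | CartanIII n => [set z : 'M[R[i]]_n | z^T = - z /\ matrix_ball z]
  | CartanProd s1 s2 => @cartan_domain R s1 `*` @cartan_domain R s2
  end.

(* Main.v *)
Require Import Defs.
From HB Require Import structures.
From mathcomp Require Import all_boot all_order all_algebra complex.
From mathcomp Require Import all_classical all_reals all_analysis.
From mathcomp Require Import zify ring lra.

(** Extremality of the data x |-> f x, for x in a family of nodes, means that no
    map holomorphic near the closed disc solves them. What has to be shown is
    that this depends only on the number of nodes.

    For a matrix ball this follows from Schur's algorithm. Let a be one of the
    nodes. A Moebius automorphism moves f a to 0, and then f is the product of
    the Blaschke factor of a and a map f1. By the maximum principle, applied to
    the linear functionals that define the ball, f1 either takes all its values
    in the ball or none of them. In the second case a and any one further node
    already give extremal data. In the first case dividing by the Blaschke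
    factor, and multiplying by it, shows that the nodes a, x_2, ..., x_m are
    extremal for f if and only if x_2, ..., x_m are extremal for f1; so by
    induction on the number of nodes any m - 1 nodes distinct from a will do
    (schur_step). Exchanging the nodes in two such moves reaches every family
    of m nodes (ball_transfer). The induction starts with one node, which is
    never extremal because of the constant maps.

    Automorphisms are taken without square roots of matrices: in place of one
    ball, the argument runs over all the domains P - z S z^* > 0, with P and S
    positive definite, which are permuted by explicit rational maps
    (moeb_identity).

    The other domains are brought back to matrix balls. Symmetric and
    skew-symmetric data that have a solution g in the matrix ball have the
    solution (g + g^T) / 2, respectively (g - g^T) / 2, in the domain of type II
    or III (signed_transferable). In a product the data are solvable near the
    closed disc if and only if both of their components are
    (prod_transferable).

    The function theory starts from pointwise complex differentiability.
    Goursat's bisection is carried out on trapezoidal sums around squares, which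
    are additive under bisection and vanish for affine functions (goursat). It
    gives a Cauchy estimate, whose constant is removed by taking powers
    (cauchy_le), then the maximum principle on discs (max_principle), also in
    the presence of points where the function is only continuous
    (max_principle_exc). The latter bounds iterated difference quotients, which
    yields Riemann's theorem on removable singularities (derivable_removable);
    the Schwarz lemma and the strong maximum principle follow (schwarz,
    strong_max). *)

Set Implicit Arguments.
Unset Strict Implicit.
Unset Printing Implicit Defensive.

Import Order.TTheory GRing.Theory Num.Theory.
Import numFieldNormedType.Exports.
Import Normc.

Local Open Scope classical_set_scope.
Local Open Scope complex_scope.
Local Open Scope ring_scope.
Local Open Scope sesquilinear_scope.

Local Notation Re := complex.Re.
Local Notation Im := complex.Im.

(** * The real-valued modulus *)

(** The norm of R[i] takes its values in the partially ordered field R[i];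
    estimates are made with normc, which takes them in R. *)

Section modulus.
Context {R : realType}.
Implicit Types z w : R[i].

Lemma norm_normc z : `|z| = (normc z)%:C.
Proof. by []. Qed.

Lemma normc_sqr z : normc z ^+ 2 = Re z ^+ 2 + Im z ^+ 2.
Proof. by case: z => a b; rewrite sqr_sqrtr ?addr_ge0 ?sqr_ge0. Qed.

Lemma normc_ge0 z : 0 <= normc z.
Proof. by case: z => a b; exact: sqrtr_ge0. Qed.

Lemma normc_eq0 z : (normc z == 0) = (z == 0).
Proof. by apply/eqP/eqP => [/eq0_normc|->]; rewrite ?normc0. Qed.

Lemma normc_gt0 z : (0 < normc z) = (z != 0).
Proof. by rewrite lt_neqAle normc_ge0 andbT eq_sym normc_eq0. Qed.

Lemma normcD z w : normc (z + w) <= normc z + normc w.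
Proof. exact: le_normcD. Qed.

Lemma normc_opp z : normc (- z) = normc z.
Proof. exact: normcN. Qed.

Lemma normc_distC z w : normc (z - w) = normc (w - z).
Proof. by rewrite -normc_opp opprB. Qed.

Lemma normcB z w : normc (z - w) <= normc z + normc w.
Proof. by rewrite -[normc w]normc_opp normcD. Qed.

Lemma normc_triB z w : normc z - normc w <= normc (z - w).
Proof. by rewrite lerBlDr -{1}[z](subrK w) normcD. Qed.

Lemma normcX z n : normc (z ^+ n) = normc z ^+ n.
Proof. by elim: n => [|n IH]; rewrite ?expr0 ?normc1 // !exprS normcM IH. Qed.

Lemma normc_real (x : R) : normc x%:C = `|x|.
Proof. by rewrite /normc /real_complex_def /= expr0n /= addr0 sqrtr_sqr. Qed.

Lemma normc_nat n : normc (n%:R : R[i]) = n%:R.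
Proof. by rewrite -(rmorph_nat (real_complex R)) normc_real ger0_norm. Qed.

Lemma normc_half z : normc (z / 2) = normc z / 2.
Proof. by rewrite normcM normcV normc_nat. Qed.

Lemma ReD z w : Re (z + w) = Re z + Re w.
Proof. by case: z w => ? ? []. Qed.

Lemma ImD z w : Im (z + w) = Im z + Im w.
Proof. by case: z w => ? ? []. Qed.

Lemma Im_half z : Im (z / 2) = Im z / 2.
Proof.
rewrite -[2 in LHS](rmorph_nat (real_complex R)) -fmorphV.
by case: z => a b /=; ring.
Qed.

Lemma real_half (x : R) : (x / 2)%:C = x%:C / 2.
Proof. by rewrite rmorphM fmorphV /= rmorph_nat. Qed.

Lemma normcJ z : normc z^* = normc z.
Proof. by case: z => a b; rewrite /normc /= sqrrN. Qed.

Lemma normc_i : normc 'i%C = 1 :> R.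
Proof. by rewrite /normc expr0n /= add0r expr1n sqrtr1. Qed.

Lemma ler_normcRe z : `|Re z| <= normc z.
Proof.
case: z => a b /=; rewrite -[leLHS]ger0_norm // -sqrtr_sqr ler_wsqrtr //.
by rewrite real_normK ?num_real // lerDl sqr_ge0.
Qed.

Lemma ler_normcIm z : `|Im z| <= normc z.
Proof.
case: z => a b /=; rewrite -[leLHS]ger0_norm // -sqrtr_sqr ler_wsqrtr //.
by rewrite real_normK ?num_real // lerDr sqr_ge0.
Qed.

Lemma ler_normcReIm z : normc z <= `|Re z| + `|Im z|.
Proof.
rewrite -[leRHS]ger0_norm ?addr_ge0 // -sqrtr_sqr.
case: z => a b /=; rewrite ler_wsqrtr //.
have := normr_ge0 a; have := normr_ge0 b.
rewrite -[a ^+ 2]real_normK ?num_real // -[b ^+ 2]real_normK ?num_real //; nra.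
Qed.

Lemma discE (z : R[i]^o) : disc z = (normc z < 1) :> Prop.
Proof. by rewrite /disc /= norm_normc -[1]/(1%:C) ltcR. Qed.

Lemma closed_discE (z : R[i]^o) : closed_disc z = (normc z <= 1) :> Prop.
Proof. by rewrite /closed_disc /= norm_normc -[1]/(1%:C) lecR. Qed.

Lemma nbhs_normcP (z : R[i]^o) (A : set R[i]^o) :
  nbhs z A <-> exists2 d : R, 0 < d & forall w, normc (w - z) < d -> A w.
Proof.
split=> [/nbhs_ballP[e /= e0 zA]|[d d0 zA]].
  have e_real : e = (Re e)%:C by rewrite RRe_real // gtr0_real.
  exists (Re e) => [|w wz]; first by rewrite -ltcR -e_real.
  by apply: zA; rewrite -ball_normE /= distrC norm_normc e_real ltcR.
apply/nbhs_ballP; exists d%:C => [/=|w]; first by rewrite ltcR.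
by rewrite -ball_normE /= distrC norm_normc ltcR; exact: zA.
Qed.

Lemma continuous_normcP (f : R[i]^o -> R[i]^o) (z : R[i]^o) :
  {for z, continuous f} <-> forall e : R, 0 < e ->
    exists2 d : R, 0 < d & forall w, normc (w - z) < d -> normc (f w - f z) < e.
Proof.
split=> [fz e e0|fz A /nbhs_normcP[e e0 fzA]]; last first.
  by apply/nbhs_normcP; have [d d0 fd] := fz _ e0; exists d => // w /fd /fzA.
have /fz/nbhs_normcP// : nbhs (f z) [set w | normc (w - f z) < e].
by apply/nbhs_normcP; exists e.
Qed.

Lemma dnbhs0P (A : set R[i]^o) :
  (0 : R[i]^o)^' A <->
  exists2 d : R, 0 < d & forall h, h != 0 -> normc h < d -> A h.
Proof.
split=> [/nbhs_normcP[d d0 dA]|[d d0 dA]].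
  by exists d => // h h0 hd; apply: dA; rewrite ?subr0.
by apply/nbhs_normcP; exists d => // h; rewrite subr0 => hd h0; exact: dA.
Qed.

Lemma derivable_normcP (f : R[i]^o -> R[i]^o) (z : R[i]^o) :
  derivable f z 1 <-> exists l : R[i], forall e : R, 0 < e ->
    exists2 d : R, 0 < d & forall w, w != z -> normc (w - z) < d ->
      normc ((f w - f z) / (w - z) - l) < e.
Proof.
split=> [/cvg_ex[/= l fl]|[l fl]].
  exists l => e e0.
  have /fl/dnbhs0P[d d0 fd] : nbhs (l : R[i]^o) [set w | normc (w - l) < e].
    by apply/nbhs_normcP; exists e.
  exists d => // w wz wd; have /= := fd (w - z).
  rewrite subr_eq0 => /(_ wz wd); rewrite [_ *: 1]mulr1 subrK.
  by rewrite [_ *: _]mulrC.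
apply/cvg_ex; exists l => A /nbhs_normcP[e e0 lA]; apply/dnbhs0P.
have [d d0 fd] := fl e e0; exists d => // h h0 hd; apply: lA.
rewrite /= [_ *: _]mulrC [_ *: 1]mulr1.
have := fd (h + z); rewrite addrK; apply => //.
by rewrite -subr_eq0 addrK.
Qed.

End modulus.

(** * Goursat's theorem for squares, with trapezoidal sums *)

Section trapezoidal_sums.
Context {R : realType}.
Local Notation C := R[i]^o.
Implicit Types (f g : C -> C) (p d z w : C).

(** The composite trapezoidal rule with 2 ^ n steps for the integral of f from
    p to p + d. It is additive under halving by definition, and exact on
    affine functions: these two properties are all that Goursat's argument
    asks of an integral. *)
Fixpoint trapezoid f n p d : C :=
  if n is n'.+1 then trapezoid f n' p (d / 2) + trapezoid f n' (p + d / 2) (d / 2)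
  else (f p + f (p + d)) / 2 * d.

Lemma trapezoidB f g n p d :
  trapezoid (fun w => f w - g w) n p d = trapezoid f n p d - trapezoid g n p d.
Proof. by elim: n p d => [|n IH] p d /=; rewrite ?IH; ring. Qed.

Lemma trapezoidZ c f n p d :
  trapezoid (fun w => c * f w) n p d = c * trapezoid f n p d.
Proof. by elim: n p d => [|n IH] p d /=; rewrite ?IH; ring. Qed.

Lemma trapezoid_affine c l n p d :
  trapezoid (fun w => c + l * w) n p d = c * d + l * (p * d + d ^+ 2 / 2).
Proof. by elim: n p d => [|n IH] p d /=; rewrite ?IH; field. Qed.

Lemma trapezoid_rev f n p d :
  trapezoid f n (p + d) (- d) = - trapezoid f n p d.
Proof.
elim: n p d => [|n IH] p d /=; first by rewrite addrK; ring.
have -> : p + d = p + d / 2 + d / 2 by field.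
by rewrite !mulNr IH addrK IH; ring.
Qed.

Lemma trapezoid_bound f n p d (M : R) :
  (forall t : R, 0 <= t <= 1 -> normc (f (p + t%:C * d)) <= M) ->
  normc (trapezoid f n p d) <= M * normc d.
Proof.
elim: n p d => [|n IH] p d fM /=.
  rewrite normcM normc_half ler_wpM2r ?normc_ge0 // ler_pdivrMr //.
  apply: le_trans (normcD _ _) _.
  have := fM 0; have := fM 1; rewrite mul1r mul0r addr0 !lexx !ler01 => /(_ isT).
  by move=> ? /(_ isT) ?; lra.
rewrite (le_trans (normcD _ _)) //.
have -> : M * normc d = M * normc (d / 2) + M * normc (d / 2) by rewrite normc_half; field.
rewrite lerD // IH // => t t01.
  have -> : t%:C * (d / 2) = (t / 2)%:C * d by rewrite real_half; field.
  by apply: fM; lra.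
have -> : p + d / 2 + t%:C * (d / 2) = p + ((1 + t) / 2)%:C * d.
  by rewrite real_half rmorphD rmorph1; field.
by apply: fM; lra.
Qed.

(** Serves to bound from below the sums of the kernel (w - a)^-1, side by
    side. *)
Lemma trapezoid_Im f n p d (c : R) :
  (forall t : R, 0 <= t <= 1 -> c <= Im (f (p + t%:C * d) * d)) ->
  c <= Im (trapezoid f n p d).
Proof.
elim: n p d c => [|n IH] p d c fM /=.
  rewrite mulrAC Im_half mulrDl ImD.
  have := fM 0; have := fM 1; rewrite mul1r mul0r addr0 !lexx !ler01 => /(_ isT).
  by move=> ? /(_ isT) ?; lra.
rewrite ImD (_ : c = c / 2 + c / 2); last by field.
rewrite lerD // IH // => t t01; rewrite mulrA Im_half ler_pM2r ?invr_gt0 //.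
  have -> : t%:C * (d / 2) = (t / 2)%:C * d.
    by rewrite real_half; field.
  by apply: fM; lra.
have -> : p + d / 2 + t%:C * (d / 2) = p + ((1 + t) / 2)%:C * d.
  by rewrite real_half rmorphD rmorph1; field.
by apply: fM; lra.
Qed.

(** The sum around the square with corners p, p + d, p + d + i d, p + i d,
    taken counterclockwise. *)
Definition bdry f n p d : C :=
  trapezoid f n p d + trapezoid f n (p + d) ('i%C * d)
  - trapezoid f n (p + 'i%C * d) d - trapezoid f n p ('i%C * d).

Lemma bdryB f g n p d :
  bdry (fun w => f w - g w) n p d = bdry f n p d - bdry g n p d.
Proof. by rewrite /bdry !trapezoidB; ring. Qed.

Lemma bdryZ c f n p d : bdry (fun w => c * f w) n p d = c * bdry f n p d.
Proof. by rewrite /bdry !trapezoidZ; ring. Qed.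

(** The reason why only the remainder of the first order expansion of f
    matters on a small square. *)
Lemma bdry_affine c l n p d : bdry (fun w => c + l * w) n p d = 0.
Proof. by rewrite /bdry !trapezoid_affine; ring. Qed.

Lemma bdry_quarters f n p d : bdry f n.+1 p d =
  bdry f n p (d / 2) + bdry f n (p + d / 2) (d / 2) +
  bdry f n (p + 'i%C * (d / 2)) (d / 2) +
  bdry f n (p + d / 2 + 'i%C * (d / 2)) (d / 2).
Proof.
rewrite /bdry /=.
have hi : 'i%C * d / 2 = 'i%C * (d / 2) by rewrite mulrA.
have e1 : p + d = p + d / 2 + d / 2 by field.
have e2 : p + 'i%C * d = p + 'i%C * (d / 2) + 'i%C * (d / 2) by field.
have e3 : p + 'i%C * (d / 2) + d / 2 = p + d / 2 + 'i%C * (d / 2) by ring.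
have e4 : p + 'i%C * (d / 2) + 'i%C * (d / 2) + d / 2 =
          p + d / 2 + 'i%C * (d / 2) + 'i%C * (d / 2) by ring.
have e5 : p + d / 2 + 'i%C * (d / 2) + d / 2 =
          p + d / 2 + d / 2 + 'i%C * (d / 2) by ring.
by rewrite hi e1 e2 e3 e4 e5; ring.
Qed.

(** A square is described from each of its four corners by rotating d; this
    lets a given corner play the part of p. *)
Lemma bdry_rot f n p d : bdry f n p ('i%C * d) = bdry f n (p - d) d.
Proof.
rewrite /bdry mulrA -expr2 sqr_i mulN1r.
have -> : p + - d + 'i%C * d = p + 'i%C * d - d by ring.
have -> : trapezoid f n p (- d) = - trapezoid f n (p - d) d.
  by rewrite -trapezoid_rev subrK.
have -> : trapezoid f n (p + 'i%C * d) (- d) = - trapezoid f n (p + 'i%C * d - d) d.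
  by rewrite -trapezoid_rev subrK.
by rewrite subrK; ring.
Qed.

Definition sqr_pt p d (s t : R) : C := p + (s +i* t) * d.

Lemma bdry_bound f n p d (M : R) :
  (forall s t : R, 0 <= s <= 1 -> 0 <= t <= 1 ->
     [|| s == 0, s == 1, t == 0 | t == 1] -> normc (f (sqr_pt p d s t)) <= M) ->
  normc (bdry f n p d) <= 4 * M * normc d.
Proof.
move=> fM; have i0 : 0 <= (0 : R) <= 1 by rewrite lexx ler01.
have i1 : 0 <= (1 : R) <= 1 by rewrite lexx ler01.
have nid : normc ('i%C * d) = normc d by rewrite normcM normc_i mul1r.
have cE (s t : R) : s +i* t = s%:C + t%:C * 'i%C by simpc.
rewrite /bdry.
have T1 : normc (trapezoid f n p d) <= M * normc d.
  by apply: trapezoid_bound => t t01; apply: (fM t 0 t01 i0); rewrite eqxx !orbT.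
have T2 : normc (trapezoid f n (p + d) ('i%C * d)) <= M * normc d.
  rewrite -nid; apply: trapezoid_bound => t t01; have := fM 1 t i1 t01.
  rewrite /sqr_pt cE (_ : p + d + _ = p + (1%:C + t%:C * 'i%C) * d); last by ring.
  by apply; rewrite eqxx !orbT.
have T3 : normc (trapezoid f n (p + 'i%C * d) d) <= M * normc d.
  apply: trapezoid_bound => t t01; have := fM t 1 t01 i1.
  rewrite /sqr_pt cE (_ : p + 'i%C * d + _ = p + (t%:C + 1%:C * 'i%C) * d); last by ring.
  by apply; rewrite eqxx !orbT.
have T4 : normc (trapezoid f n p ('i%C * d)) <= M * normc d.
  rewrite -nid; apply: trapezoid_bound => t t01; have := fM 0 t i0 t01.
  rewrite /sqr_pt cE (_ : p + t%:C * ('i%C * d) = p + (0%:C + t%:C * 'i%C) * d);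
    last by ring.
  by apply; rewrite eqxx.
apply: le_trans (normcB _ _) _.
apply: le_trans (lerD (normcB _ _) (lexx _)) _.
apply: le_trans (lerD (lerD (normcD _ _) (lexx _)) (lexx _)) _.
lra.
Qed.

End trapezoidal_sums.

Section goursat.
Context {R : realType}.
Local Notation C := R[i]^o.
Implicit Types (f g : C -> C) (p d z w : C).

Lemma pow2_unbounded (x : R) : exists k, x < 2 ^+ k.
Proof.
exists (Num.bound `|x|); apply: le_lt_trans (ler_norm x) _.
apply: lt_le_trans (archi_boundP (normr_ge0 x)) _.
by rewrite -natrX ler_nat ltnW // ltn_expl.
Qed.

(** Completeness of R, for nested dyadic intervals. *)
Lemma dyadic_nested (u : nat -> R) :
  (forall k, u k <= u k.+1 <= u k + 2^-1 ^+ k.+1) ->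
  exists x, forall k, u k <= x <= u k + 2^-1 ^+ k.
Proof.
move=> uS.
have inc j k : u k <= u (j + k)%N.
  by elim: j => // j IH; rewrite addSn (le_trans IH) //; case/andP: (uS (j + k)%N).
have dec j k : u (j + k)%N + 2^-1 ^+ (j + k) <= u k + 2^-1 ^+ k.
  elim: j => // j IH; apply: le_trans IH; rewrite addSn.
  by have /andP[_] := uS (j + k)%N; rewrite exprS; lra.
have pos k : 0 <= 2^-1 ^+ k :> R by rewrite exprn_ge0.
have ub k j : u j <= u k + 2^-1 ^+ k.
  case/orP: (leq_total j k) => jk.
    by rewrite -(subnK jk) (le_trans (inc (k - j)%N j)) // lerDl.
  by have := dec (j - k)%N k; rewrite subnK //; have := pos j; lra.
exists (sup (range u)) => k; apply/andP; split.
  by apply: ub_le_sup; [exists (u 0 + 2^-1 ^+ 0) => _ [j _ <-]; exact: ub|exists k].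
by apply: ge_sup; [exists (u 0), 0|move=> _ [j _ <-]; exact: ub].
Qed.

(** A bound for the contour integral: it only concerns the upper limit of the
    trapezoidal sums, so that their convergence never has to be established. *)
Definition bdry_le f p d (e : R) :=
  exists N, forall n, (N <= n)%N -> normc (bdry f n p d) <= e.

Lemma sqr_pt_trans p d s t s' t' (h : R) :
  sqr_pt (sqr_pt p d s t) (h%:C * d) s' t' = sqr_pt p d (s + h * s') (t + h * t').
Proof.
by rewrite /sqr_pt -addrA mulrA -mulrDl; congr (_ + _ * _); simpc; congr Complex; ring.
Qed.

Lemma complex_split (s t : R) : s +i* t = s%:C + t%:C * 'i%C.
Proof. by simpc. Qed.

Lemma real_inv2 : (2^-1 : R)%:C = 2^-1.
Proof. by rewrite fmorphV /= rmorph_nat. Qed.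

Lemma sqr_pt00 p d : sqr_pt p d 0 0 = p.
Proof. by rewrite /sqr_pt complex_split rmorph0; ring. Qed.

Lemma sqr_pt10 p d : sqr_pt p d 2^-1 0 = p + d / 2.
Proof. by rewrite /sqr_pt complex_split rmorph0 real_inv2; ring. Qed.

Lemma sqr_pt01 p d : sqr_pt p d 0 2^-1 = p + 'i%C * (d / 2).
Proof. by rewrite /sqr_pt complex_split rmorph0 real_inv2; ring. Qed.

Lemma sqr_pt11 p d : sqr_pt p d 2^-1 2^-1 = p + d / 2 + 'i%C * (d / 2).
Proof. by rewrite /sqr_pt complex_split real_inv2; ring. Qed.

Lemma bdry_le_quarters f p d e1 e2 e3 e4 :
  bdry_le f (sqr_pt p d 0 0) (d / 2) e1 ->
  bdry_le f (sqr_pt p d 2^-1 0) (d / 2) e2 ->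
  bdry_le f (sqr_pt p d 0 2^-1) (d / 2) e3 ->
  bdry_le f (sqr_pt p d 2^-1 2^-1) (d / 2) e4 ->
  bdry_le f p d (e1 + e2 + e3 + e4).
Proof.
rewrite sqr_pt00 sqr_pt10 sqr_pt01 sqr_pt11 => -[N1 h1] [N2 h2] [N3 h3] [N4 h4].
exists (N1 + N2 + N3 + N4).+1 => -[//|n nN].
rewrite bdry_quarters.
have {}h1 := h1 n ltac:(lia); have {}h2 := h2 n ltac:(lia).
have {}h3 := h3 n ltac:(lia); have {}h4 := h4 n ltac:(lia).
do 3 (apply: le_trans (normcD _ _) _; apply: lerD => //).
Qed.

(** The bisection step of Goursat's argument. *)
Lemma bdry_le_quarter f p d e : ~ bdry_le f p d e ->
  exists ab : R * R, [/\ 0 <= ab.1 <= 2^-1, 0 <= ab.2 <= 2^-1 &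
    ~ bdry_le f (sqr_pt p d ab.1 ab.2) (d / 2) (e / 4)].
Proof.
move=> nle; apply/not_existsP => nq; apply: nle.
have q a b : 0 <= a <= 2^-1 -> 0 <= b <= 2^-1 ->
    bdry_le f (sqr_pt p d a b) (d / 2) (e / 4).
  by move=> ha hb; apply: contrapT => h; apply: (nq (a, b)).
rewrite (_ : e = e / 4 + e / 4 + e / 4 + e / 4); last by field.
by apply: bdry_le_quarters; apply: q; rewrite ?lexx ?invr_ge0 ?ler0n.
Qed.

Lemma derivable_approx f z : derivable f z 1 -> exists l : C, forall e : R, 0 < e ->
  exists2 r : R, 0 < r & forall w, normc (w - z) < r ->
    normc (f w - (f z + l * (w - z))) <= e * normc (w - z).
Proof.
move=> /derivable_normcP[l fl]; exists l => e e0.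
have [r r0 fr] := fl _ e0; exists r => // w wr.
have [->|wz] := eqVneq w z.
  by rewrite subrr mulr0 addr0 subrr normc0 mulr0.
have wz0 : w - z != 0 by rewrite subr_eq0.
rewrite -ler_pdivrMr ?normc_gt0 // -normcV -normcM; apply: le_trans (ltW (fr _ wz wr)).
by rewrite le_eqVlt (_ : _ / _ = (f w - f z) / (w - z) - l) ?eqxx //; field.
Qed.

Lemma bdry_small f z l p d (e : R) n :
  (forall s t : R, 0 <= s <= 1 -> 0 <= t <= 1 ->
     normc (f (sqr_pt p d s t) - (f z + l * (sqr_pt p d s t - z))) <= e) ->
  normc (bdry f n p d) <= 4 * e * normc d.
Proof.
move=> fe.
have -> : bdry f n p d = bdry (fun w => f w - (f z + l * (w - z))) n p d.
  rewrite bdryB (_ : (fun w => f z + l * (w - z)) = (fun w => (f z - l * z) + l * w)).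
    by rewrite bdry_affine subr0.
  by apply/funext => w; ring.
by apply: bdry_bound => s t hs ht _; exact: fe.
Qed.

Lemma normc_sqr_pt p d s t s' t' :
  normc (sqr_pt p d s t - sqr_pt p d s' t') <= (`|s - s'| + `|t - t'|) * normc d.
Proof.
rewrite /sqr_pt opprD addrACA subrr add0r -mulrBl normcM ler_wpM2r ?normc_ge0 //.
exact: (ler_normcReIm ((s +i* t) - (s' +i* t'))).
Qed.

(** If the sums exceeded e in the limit, bisection would produce squares of
    side 2 ^- k |d| shrinking to a point z, whose sums exceed e / 4 ^ k.
    Differentiability at z makes the remainder on them o(2 ^- k), hence the
    sums o(4 ^- k). *)
Lemma goursat f p d :
  (forall s t : R, 0 <= s <= 1 -> 0 <= t <= 1 -> derivable f (sqr_pt p d s t) 1) ->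
  forall e : R, 0 < e -> bdry_le f p d e.
Proof.
move=> df e e0; apply: contrapT => nle.
pose bad k (st : R * R) :=
  ~ bdry_le f (sqr_pt p d st.1 st.2) ((2^-1 ^+ k)%:C * d) (e / 4 ^+ k).
have step (x : nat * (R * R)) : exists ab : R * R,
    bad x.1 x.2 -> [/\ 0 <= ab.1 <= 2^-1, 0 <= ab.2 <= 2^-1 &
      bad x.1.+1 (x.2.1 + 2^-1 ^+ x.1 * ab.1, x.2.2 + 2^-1 ^+ x.1 * ab.2)].
  case: (pselect (bad x.1 x.2)) => [/bdry_le_quarter[ab [h1 h2 h3]]|nb]; last first.
    by exists (0, 0).
  exists ab => _; split=> //; rewrite /bad /=.
  rewrite sqr_pt_trans in h3.
  rewrite exprSr real_half exprS invfM mulrCA [4^-1 * _]mulrC.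
  by rewrite (_ : _ / 2 * d = (2^-1 ^+ x.1)%:C * d / 2) //; ring.
have [nxt nxtP] := choice step.
pose st := fix st k : R * R := if k is k'.+1 then
   ((st k').1 + 2^-1 ^+ k' * (nxt (k', st k')).1,
    (st k').2 + 2^-1 ^+ k' * (nxt (k', st k')).2) else (0, 0).
have badst k : bad k (st k).
  elim: k => [|k IH]; last by have [] := nxtP (k, st k) IH.
  by rewrite /bad /= !expr0 mul1r divr1 sqr_pt00.
have hpos k : 0 < 2^-1 ^+ k :> R by rewrite exprn_gt0 // invr_gt0.
have [s sP] : exists x, forall k, (st k).1 <= x <= (st k).1 + 2^-1 ^+ k.
  apply: dyadic_nested => k; have [/andP[a0 a1] _ _] := nxtP (k, st k) (badst k).
  rewrite /= lerDl lerD2l exprSr mulr_ge0 ?(ltW (hpos _)) //=.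
  by rewrite ler_wpM2l // ltW.
have [t tP] : exists x, forall k, (st k).2 <= x <= (st k).2 + 2^-1 ^+ k.
  apply: dyadic_nested => k; have [_ /andP[a0 a1] _] := nxtP (k, st k) (badst k).
  rewrite /= lerDl lerD2l exprSr mulr_ge0 ?(ltW (hpos _)) //=.
  by rewrite ler_wpM2l // ltW.
pose z := sqr_pt p d s t.
have /derivable_approx[l lP] : derivable f z 1.
  by apply: df; [have := sP 0%N|have := tP 0%N]; rewrite /= expr0 add0r.
(* four sides, and the diameter of a square of side h is at most 2 h *)
have c0 : 0 < 8 * normc d ^+ 2 + 1 by rewrite ltr_wpDl // mulr_ge0 // sqr_ge0.
have [r r0 rP] := lP (e / (8 * normc d ^+ 2 + 1)) (divr_gt0 e0 c0).
have [k kP] := pow2_unbounded (2 * normc d / r).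
apply: (badst k); exists 0%N => n _.
set h : R := 2^-1 ^+ k.
have h0 : 0 < h := hpos k.
have hr : 2 * h * normc d < r.
  move: kP; rewrite ltr_pdivrMr // -ltr_pdivrMl ?exprn_gt0 // -exprVn -/h; nra.
have nhd : normc (h%:C * d) = h * normc d.
  by rewrite normcM normc_real gtr0_norm.
set c := 8 * _ + 1 in c0 rP.
have := @bdry_small f z l (sqr_pt p d (st k).1 (st k).2) (h%:C * d)
  (e / c * (2 * h * normc d)) n.
rewrite nhd => bs; apply: le_trans (bs _) _ => [s' t' hs ht|]; last first.
  have -> : e / 4 ^+ k = e * h ^+ 2.
    by rewrite /h exprAC (_ : 2^-1 ^+ 2 = 4^-1 :> R) ?exprVn // -natrX.
  have -> : 4 * (e / c * (2 * h * normc d)) * (h * normc d) =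
      e * h ^+ 2 * (8 * normc d ^+ 2 / c) by ring.
  rewrite ler_piMr ?ler_pdivrMr // ?mul1r ?lerDl //.
  by rewrite mulr_ge0 ?sqr_ge0 // ltW.
rewrite sqr_pt_trans.
have dist : normc (sqr_pt p d ((st k).1 + h * s') ((st k).2 + h * t') - z)
    <= 2 * h * normc d.
  apply: le_trans (normc_sqr_pt _ _ _ _ _ _) _; rewrite ler_wpM2r ?normc_ge0 //.
  have := sP k; have := tP k; rewrite -/h => htP hsP.
  have : `|(st k).1 + h * s' - s| <= h by rewrite ler_norml; nra.
  have : `|(st k).2 + h * t' - t| <= h by rewrite ler_norml; nra.
  lra.
apply: le_trans (rP _ (le_lt_trans dist hr)) _.
by rewrite ler_wpM2l // ltW // divr_gt0.
Qed.

End goursat.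

(** * Cauchy's estimate *)

Section cauchy.
Context {R : realType}.
Local Notation C := R[i]^o.
Implicit Types (f g : C -> C) (p d z w a : C).

Lemma normc_sqr_pt_le p d s t : 0 <= s <= 1 -> 0 <= t <= 1 ->
  normc (sqr_pt p d s t - p) <= 2 * normc d.
Proof.
move=> hs ht; rewrite -{2}[p](sqr_pt00 p d).
apply: le_trans (normc_sqr_pt _ _ _ _ _ _) _; rewrite ler_wpM2r ?normc_ge0 //.
by rewrite !subr0 !ger0_norm; lra.
Qed.

Lemma sqr_pt_eq p d s t : d != 0 -> sqr_pt p d s t = p -> s = 0 /\ t = 0.
Proof.
move=> d0 /eqP; rewrite -subr_eq0 /sqr_pt addrC addKr mulf_eq0 (negPf d0) orbF.
by move=> /eqP[].
Qed.

Lemma bdry_leW f p d (e e' : R) : e <= e' -> bdry_le f p d e -> bdry_le f p d e'.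
Proof. by move=> ee' [N h]; exists N => n /h /le_trans; apply. Qed.

Lemma bdry_le_rot f p d e : bdry_le f p ('i%C * d) e <-> bdry_le f (p - d) d e.
Proof. by split=> -[N h]; exists N => n /h; rewrite bdry_rot. Qed.

(** Of the four quarters of the square, the three that avoid p are covered by
    goursat, so in the limit the sum is that of the quarter at p. *)
Lemma bdry_le_corner_shrink f p d k (e e' : R) : d != 0 ->
  (forall s t : R, 0 <= s <= 1 -> 0 <= t <= 1 -> (s, t) != (0, 0) ->
     derivable f (sqr_pt p d s t) 1) ->
  e < e' -> bdry_le f p ((2^-1 ^+ k)%:C * d) e -> bdry_le f p d e'.
Proof.
elim: k d e e' => [|k IH] d e e' d0 df ee'; first by rewrite mul1r; apply: bdry_leW; lra.
rewrite (_ : (_ %:C * d) = (2^-1 ^+ k)%:C * (d / 2)) => [h|]; last first.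
  by rewrite exprSr real_half; ring.
have half_pt q s t : sqr_pt q (d / 2) s t = sqr_pt q d (s / 2) (t / 2).
  by rewrite /sqr_pt [in LHS]complex_split [in RHS]complex_split !real_half; field.
have q1 : bdry_le f p (d / 2) (e + (e' - e) / 4).
  have d20 : d / 2 != 0 by rewrite mulf_neq0 ?invr_neq0 ?pnatr_eq0.
  apply: (IH (d / 2) e _ d20 _ _ h); last by lra.
  move=> s t hs ht st0; rewrite half_pt; apply: df; [lra|lra|].
  by apply: contra st0; rewrite !xpair_eqE !mulf_eq0 invr_eq0 !pnatr_eq0 !orbF.
rewrite (_ : e' = e + (e' - e) / 4 + (e' - e) / 4 + (e' - e) / 4 + (e' - e) / 4);
  last by field.
have q (a b : R) : 0 <= a <= 2^-1 -> 0 <= b <= 2^-1 -> 0 < a + b ->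
    bdry_le f (sqr_pt p d a b) (d / 2) ((e' - e) / 4).
  move=> ha hb ab; apply: goursat => [s t hs ht|]; last by lra.
  rewrite (_ : d / 2 = (2^-1)%:C * d); last by rewrite real_inv2 mulrC.
  rewrite sqr_pt_trans; apply: df; [lra|lra|].
  by apply: contraTneq ab => -[h1 h2]; lra.
by apply: bdry_le_quarters; rewrite ?sqr_pt00 //; apply: q; lra.
Qed.

(** A corner where f is only continuous does no harm: f is bounded near it, so
    the sum around a square of side h at that corner is O(h). *)
Lemma goursat_corner f p d : d != 0 -> {for p, continuous f} ->
  (forall w, w != p -> normc (w - p) <= 2 * normc d -> derivable f w 1) ->
  forall e : R, 0 < e -> bdry_le f p d e.
Proof.
move=> d0 /continuous_normcP cf df e e0.
have [r r0 fr] := cf 1 ltr01.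
pose B := normc (f p) + 1.
have B0 : 0 < B by rewrite ltr_wpDl ?normc_ge0.
have nd0 : 0 < normc d by rewrite normc_gt0.
(* k1 halvings lead to where f is bounded by B, k2 make the sums small *)
have [k1 k1P] := pow2_unbounded (2 * normc d / r).
have [k2 k2P] := pow2_unbounded (4 * B * normc d / (e / 2)).
apply: (@bdry_le_corner_shrink _ _ _ (k1 + k2) (e / 2)) => //; [|lra|].
  move=> s t hs ht st0; apply: df; last exact: normc_sqr_pt_le.
  by apply: contra st0 => /eqP/(sqr_pt_eq d0)[-> ->].
exists 0%N => n _; set h : R := 2^-1 ^+ _.
have h0 : 0 < h by rewrite exprn_gt0 // invr_gt0.
have nhd : normc (h%:C * d) = h * normc d by rewrite normcM normc_real gtr0_norm.
have pow1 j : 1 <= 2 ^+ j :> R by apply: exprn_ege1; rewrite ler1n.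
have hV : h * (2 ^+ k1 * 2 ^+ k2) = 1.
  by rewrite -exprD /h exprVn mulVf // expf_neq0 // pnatr_eq0.
have := pow1 k1; have := pow1 k2; move: k1P k2P hV.
rewrite !ltr_pdivrMr //; last by lra.
move: (2 ^+ k1) (2 ^+ k2) => x y hx hy hxy x1 y1.
have x0 : 0 <= x by lra.
have y0 : 0 <= y by lra.
have xh1 : x * h <= 1.
  have y10 : 0 <= y - 1 by lra.
  by have := mulr_ge0 (mulr_ge0 x0 (ltW h0)) y10; lra.
have yh1 : y * h <= 1.
  have x10 : 0 <= x - 1 by lra.
  by have := mulr_ge0 (mulr_ge0 y0 (ltW h0)) x10; lra.
have hr : 2 * h * normc d < r.
  have : 2 * normc d * h < x * r * h by rewrite ltr_pM2r.
  have : x * h * r <= r by rewrite ler_piMl // ltW.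
  lra.
apply: (@le_trans _ _ (4 * B * (h * normc d))); last first.
  have : 4 * B * normc d * h < y * (e / 2) * h by rewrite ltr_pM2r.
  have : y * h * (e / 2) <= e / 2 by rewrite ler_piMl //; lra.
  lra.
rewrite -nhd; apply: bdry_bound => s t hs ht _.
have /fr : normc (sqr_pt p (h%:C * d) s t - p) < r.
  by apply: le_lt_trans (normc_sqr_pt_le _ _ hs ht) _; rewrite nhd mulrA.
by have := normc_triB (f (sqr_pt p (h%:C * d) s t)) (f p); rewrite /B; lra.
Qed.

(** The square is cut into four squares that have the exceptional point a as a
    corner. *)
Lemma goursat_center f a (r : R) : 0 < r -> {for a, continuous f} ->
  (forall w, w != a -> normc (w - a) <= 2 * r -> derivable f w 1) ->
  forall e : R, 0 < e -> bdry_le f (a - 'i%C * r%:C - r%:C) (2 * r%:C) e.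
Proof.
move=> r0 cf df e e0.
have q d : normc d = r -> bdry_le f a d (e / 4).
  move=> dr; have d0 : d != 0 by rewrite -normc_gt0 dr.
  apply: (goursat_corner d0 cf); last by lra.
  by move=> w wa; rewrite dr; exact: df.
have nr : normc r%:C = r by rewrite normc_real gtr0_norm.
have nir d : normc ('i%C * d) = normc d by rewrite normcM normc_i mul1r.
have h2 : 2 * r%:C / 2 = r%:C :> C by field.
rewrite (_ : e = e / 4 + e / 4 + e / 4 + e / 4); last by field.
apply: bdry_le_quarters; rewrite ?sqr_pt00 ?sqr_pt10 ?sqr_pt01 ?sqr_pt11 h2.
- by rewrite -bdry_le_rot -bdry_le_rot; apply: q; rewrite !nir.
- rewrite subrK (_ : a - _ = a - - r%:C - 'i%C * r%:C - r%:C); last by ring.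
  rewrite -bdry_le_rot -bdry_le_rot mulrA -expr2 sqr_i mulN1r.
  by rewrite -bdry_le_rot; apply: q; rewrite nir normc_opp.
- rewrite (_ : _ + _ = a - r%:C); last by ring.
  by rewrite -bdry_le_rot; apply: q; rewrite !nir.
- by rewrite subrK subrK; exact: q.
Qed.

(** This is the imaginary part of dw / (w - a) on the bottom side of the
    square of half-side r, where w - a = r (u - i). Rotations bring the other
    sides to it. *)
Lemma kernel_Im (u r : R) : r != 0 ->
  Im ((r%:C * (u +i* -1))^-1 * (2 * r%:C)) = 2 / (u ^+ 2 + 1).
Proof.
move=> r0; have rC0 : r%:C != 0 :> R[i] by apply: contra r0 => /eqP[->].
have u0 : u +i* -1 != 0 :> R[i] by rewrite eq_complex /= oppr_eq0 oner_eq0 andbF.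
have -> : (r%:C * (u +i* -1))^-1 * (2 * r%:C) = (2 : R)%:C * (u +i* -1)^-1 :> R[i].
  rewrite rmorph_nat; move: (u +i* -1) (r%:C) u0 rC0 => x y x0 y0; field.
  by rewrite x0 y0.
by rewrite /= sqrrN expr1n; ring.
Qed.

(** Stands for the residue 2 pi i of (w - a)^-1; a lower bound on the modulus
    suffices, and each side contributes at least 1 to the imaginary part. *)
Lemma kernel_bdry a (r : R) n : 0 < r ->
  4 <= normc (bdry (fun w => (w - a)^-1) n (a - 'i%C * r%:C - r%:C) (2 * r%:C)).
Proof.
move=> r0; apply: le_trans (le_trans (ler_norm _) (ler_normcIm _)).
have ImN (x : R[i]) : Im (- x) = - Im x by case: x.
have kb (t : R) : 0 <= t <= 1 -> 1 <= 2 / ((2 * t - 1) ^+ 2 + 1).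
  move=> ht; rewrite ler_pdivlMr ?mul1r; nra.
have kb' (t : R) : 0 <= t <= 1 -> 1 <= 2 / ((1 - 2 * t) ^+ 2 + 1).
  move=> ht; rewrite ler_pdivlMr ?mul1r; nra.
have r1 : r != 0 by rewrite gt_eqF.
have uE (t : R) : (2 * t - 1) +i* -1 = 2 * t%:C - 1 - 'i%C :> C.
  by rewrite complex_split rmorphB rmorphM rmorphN /= rmorph_nat !rmorph1; ring.
have uE' (t : R) : (1 - 2 * t) +i* -1 = 1 - 2 * t%:C - 'i%C :> C.
  by rewrite complex_split rmorphB rmorphM rmorphN /= rmorph_nat !rmorph1; ring.
pose q := a - 'i%C * r%:C - r%:C; rewrite -/q; pose d : C := 2 * r%:C; rewrite -/d.
pose k := fun w : C => (w - a)^-1.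
have ii : 'i%C * 'i%C = -1 :> C by rewrite -expr2 sqr_i.
have i0 : 'i%C != 0 :> C by rewrite -normc_gt0 normc_i.
have canc (x y : C) : ('i%C * x)^-1 * ('i%C * y) = x^-1 * y.
  by rewrite invfM mulrACA mulVf // mul1r.
have b1 : 1 <= Im (trapezoid k n q d).
  apply: trapezoid_Im => t t01; apply: le_trans (kb t t01) _.
  rewrite -(kernel_Im _ r1) uE /k /q /d le_eqVlt; apply/orP; left; apply/eqP.
  by congr (Im (_^-1 * _)); ring.
have b2 : 1 <= Im (trapezoid k n (q + d) ('i%C * d)).
  apply: trapezoid_Im => t t01; apply: le_trans (kb t t01) _.
  rewrite -(kernel_Im _ r1) uE le_eqVlt; apply/orP; left; apply/eqP; congr Im.
  rewrite /k (_ : _ - a = 'i%C * (r%:C * (2 * t%:C - 1 - 'i%C))); last first.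
    rewrite /q /d; ring: ii.
  by rewrite canc.
have b3 : 1 <= - Im (trapezoid k n (q + 'i%C * d) d).
  rewrite -ImN -mulN1r -trapezoidZ; apply: trapezoid_Im => t t01.
  apply: le_trans (kb' t t01) _.
  rewrite -(kernel_Im _ r1) uE' le_eqVlt; apply/orP; left; apply/eqP; congr Im.
  rewrite /k (_ : _ - a = - (r%:C * (1 - 2 * t%:C - 'i%C))); last by rewrite /q /d; ring.
  by rewrite invrN mulrN mulN1r opprK.
have b4 : 1 <= - Im (trapezoid k n q ('i%C * d)).
  rewrite -ImN -mulN1r -trapezoidZ; apply: trapezoid_Im => t t01.
  apply: le_trans (kb' t t01) _.
  rewrite -(kernel_Im _ r1) uE' le_eqVlt; apply/orP; left; apply/eqP; congr Im.
  rewrite /k (_ : _ - a = - ('i%C * (r%:C * (1 - 2 * t%:C - 'i%C)))); last first.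
    rewrite /q /d; ring: ii.
  rewrite invrN mulrN mulN1r opprK.
  by rewrite canc.
by rewrite /bdry !ImD !ImN; rewrite /k in b1 b2 b3 b4 *; lra.
Qed.
End cauchy.

Local Opaque derivable.

Section cauchy_estimate.
Context {R : realType}.
Local Notation C := R[i]^o.
Implicit Types (f g : C -> C) (p d z w a : C).

Lemma derivable_continuous {V : normedModType R[i]} (f : C -> V) z :
  derivable f z 1 -> {for z, continuous f}.
Proof. by move=> /derivable1_diffP /differentiable_continuous. Qed.

Lemma derivable_mul f g z : derivable f z 1 -> derivable g z 1 ->
  derivable (fun w => f w * g w : C) z 1.
Proof. by move=> fz gz; exact: (derivableM fz gz). Qed.

Lemma derivable_add f g z : derivable f z 1 -> derivable g z 1 ->
  derivable (fun w => f w + g w : C) z 1.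
Proof. by move=> fz gz; exact: (derivableD fz gz). Qed.

Lemma derivable_sub f g z : derivable f z 1 -> derivable g z 1 ->
  derivable (fun w => f w - g w : C) z 1.
Proof. by move=> fz gz; exact: (derivableB fz gz). Qed.

Lemma derivable_inv f z : f z != 0 -> derivable f z 1 ->
  derivable (fun w => (f w)^-1 : C) z 1.
Proof. by move=> f0 fz; exact: (derivableV f0 fz). Qed.

Lemma derivable_const (c z : C) : derivable (fun _ : C => c) z 1.
Proof. exact: derivable_cst. Qed.

Lemma derivable_var (z : C) : derivable (fun w : C => w) z 1.
Proof. exact: derivable_id. Qed.

Lemma derivable_subr a z : derivable (fun w : C => w - a : C) z 1.
Proof. by apply: derivable_sub; [exact: derivable_var|exact: derivable_const]. Qed.

Lemma derivable_exp f n z : derivable f z 1 -> derivable (fun w => f w ^+ n : C) z 1.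
Proof.
move=> fz; elim: n => [|n IH].
  rewrite (_ : (fun _ => _) = fun=> 1); first exact: derivable_const.
  by apply/funext => w; rewrite expr0.
rewrite (_ : (fun _ => _) = fun w => f w * f w ^+ n); first exact: derivable_mul.
by apply/funext => w; rewrite exprS.
Qed.

Lemma continuous_mul f g z : {for z, continuous f} -> {for z, continuous g} ->
  {for z, continuous (fun w => f w * g w : C)}.
Proof. by move=> fz gz; exact: (continuousM fz gz). Qed.

Lemma continuous_sub f g z : {for z, continuous f} -> {for z, continuous g} ->
  {for z, continuous (fun w => f w - g w : C)}.
Proof. by move=> fz gz; exact: (continuousB fz gz). Qed.

Lemma continuous_near f g z : (\forall w \near z, f w = g w) ->
  {for z, continuous f} -> {for z, continuous g}.
Proof.
move=> fg fz A; rewrite -(nbhs_singleton fg) => /fz; apply: filterS2 fg.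
by move=> w /= ->.
Qed.

Lemma derive_normc f z : derivable f z 1 -> forall e : R, 0 < e ->
  exists2 d : R, 0 < d & forall w, w != z -> normc (w - z) < d ->
    normc ((f w - f z) / (w - z) - 'D_1 f z) < e.
Proof.
move=> fz e e0.
have /fz/dnbhs0P[d d0 fd] : nbhs ('D_1 f z : C) [set w | normc (w - 'D_1 f z) < e].
  by apply/nbhs_normcP; exists e.
exists d => // w wz wd; have /= := fd (w - z).
rewrite subr_eq0 => /(_ wz wd); rewrite [_ *: 1]mulr1 subrK.
by rewrite [_ *: _]mulrC.
Qed.

Definition dquot f a z : C :=
  if z == a then 'D_1 f a else (f z - f a) / (z - a).

Lemma dquotE f a z : z != a -> dquot f a z = (f z - f a) / (z - a).
Proof. by rewrite /dquot => /negPf ->. Qed.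

Lemma near_neq (z a : C) : z != a -> \forall w \near z, w != a.
Proof.
move=> za; apply/nbhs_normcP; exists (normc (z - a)); first by rewrite normc_gt0 subr_eq0.
by move=> w; apply: contraTneq => ->; rewrite normc_distC ltxx.
Qed.

Lemma near_dquot f a z : z != a ->
  {near z, (fun w => (f w - f a) * (w - a)^-1) =1 dquot f a}.
Proof. by move=> /near_neq; apply: filterS => w wa; rewrite dquotE. Qed.

Lemma derivable_dquot f a z : z != a -> derivable f z 1 ->
  derivable (dquot f a) z 1.
Proof.
move=> za fz; refine (near_eq_derivable (near_dquot f za) _).
apply: (derivable_mul (f := fun w => f w - f a) (g := fun w => (w - a)^-1)).
  by apply: derivable_sub; [exact: fz|exact: derivable_const].
by apply: (derivable_inv (f := fun w => w - a)); [rewrite subr_eq0|exact: derivable_subr].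
Qed.

Lemma continuous_dquot f a z : z != a -> {for z, continuous f} ->
  {for z, continuous (dquot f a)}.
Proof.
move=> za fz; refine (continuous_near (near_dquot f za) _).
apply: (continuous_mul (f := fun w => f w - f a) (g := fun w => (w - a)^-1)).
  by apply: continuous_sub; [exact: fz|exact: cst_continuous].
apply: (derivable_continuous (f := fun w => (w - a)^-1 : C)).
by apply: (derivable_inv (f := fun w => w - a)); [rewrite subr_eq0|exact: derivable_subr].
Qed.

Lemma continuous_dquot_pole f a : derivable f a 1 -> {for a, continuous (dquot f a)}.
Proof.
move=> /derive_normc fa; apply/continuous_normcP => e e0.
have [d d0 fd] := fa e e0; exists d => // w wd; rewrite {2}/dquot eqxx.
have [->|wa] := eqVneq w a; first by rewrite /dquot eqxx subrr normc0.
by rewrite dquotE //; exact: fd.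
Qed.

(** By Goursat's theorem for the difference quotient at a, the sums of f(w) /
    (w - a) and f(a) / (w - a) around the square of half-side r agree in the
    limit. The annulus in the hypothesis contains the boundary of this square. *)
Lemma cauchy_estimate f a (r M : R) : 0 < r ->
  (forall w, normc (w - a) <= 2 * r -> derivable f w 1) ->
  (forall w, r <= normc (w - a) <= 2 * r -> normc (f w) <= M) ->
  normc (f a) <= 2 * M.
Proof.
move=> r0 df fM.
suff bound e : 0 < e -> 4 * normc (f a) <= 8 * M + e.
  apply/ler_addgt0Pr => e e0.
  have e40 : 0 < 4 * e by rewrite mulr_gt0.
  by have := bound _ e40; lra.
move=> e0.
pose q := a - 'i%C * r%:C - r%:C; pose d : C := 2 * r%:C.
have nd : normc d = 2 * r by rewrite /d normcM normc_nat normc_real gtr0_norm.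
have df_a : derivable f a 1 by apply: df; rewrite subrr normc0; lra.
have [N NP] : bdry_le (dquot f a) q d e.
  apply: (goursat_center r0 (continuous_dquot_pole df_a)); last exact: e0.
  by move=> w wa wr; apply: derivable_dquot wa _; exact: df.
have ptE s t : sqr_pt q d s t - a = r%:C * ((2 * s - 1) +i* (2 * t - 1)).
  rewrite /sqr_pt /q /d [s +i* t]complex_split [(2 * s - 1) +i* _]complex_split.
  by rewrite !rmorphB !rmorphM /= !rmorph_nat !rmorph1; ring.
have edge s t : 0 <= s <= 1 -> 0 <= t <= 1 -> [|| s == 0, s == 1, t == 0 | t == 1] ->
    r <= normc (sqr_pt q d s t - a) <= 2 * r.
  move=> hs ht hst; rewrite ptE normcM normc_real gtr0_norm // mulrC.
  rewrite ler_pM2r // ler_peMl ?(ltW r0) //; last first.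
    case/or4P: hst => /eqP ->.
    - by apply: le_trans (ler_normcRe _) => /=; rewrite mulr0 sub0r normrN1.
    - by apply: le_trans (ler_normcRe _) => /=; rewrite mulr1 addrK normr1.
    - by apply: le_trans (ler_normcIm _) => /=; rewrite mulr0 sub0r normrN1.
    - by apply: le_trans (ler_normcIm _) => /=; rewrite mulr1 addrK normr1.
  apply: le_trans (ler_normcReIm _) _ => /=.
  have : `|2 * s - 1| <= 1 by rewrite ler_norml; lra.
  have : `|2 * t - 1| <= 1 by rewrite ler_norml; lra.
  lra.
pose k w : C := (w - a)^-1; pose g w := dquot f a w - (- f a) * k w.
have gE w : w != a -> g w = f w / (w - a).
  by move=> wa; rewrite /g dquotE // /k; ring.
have gB : normc (bdry g N q d) <= 4 * (M / r) * (2 * r).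
  rewrite -nd; apply: bdry_bound => s t hs ht hst; have hr := edge s t hs ht hst.
  have pr : 0 < normc (sqr_pt q d s t - a) by case/andP: hr => [+ _]; exact: lt_le_trans.
  have wa : sqr_pt q d s t != a by rewrite -subr_eq0 -normc_gt0.
  rewrite (gE _ wa) normcM normcV ler_pdivrMr //; apply: le_trans (fM _ hr) _.
  have M0 : 0 <= M by apply: le_trans (normc_ge0 _) (fM _ hr).
  rewrite mulrAC ler_pdivlMr // ler_wpM2l //.
  by case/andP: hr.
have : normc (f a * bdry k N q d) <= 8 * M + e.
  have -> : f a * bdry k N q d = bdry g N q d - bdry (dquot f a) N q d.
    by rewrite /g bdryB bdryZ; ring.
  apply: le_trans (normcB _ _) _; apply: lerD; last exact: NP.
  have rE : 4 * (M / r) * (2 * r) = 8 * (M / r * r) by ring.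
  by rewrite rE divfK ?gt_eqF in gB.
have := kernel_bdry a N r0; rewrite -/q -/d -/k => k4; rewrite normcM.
by apply: le_trans; rewrite mulrC ler_wpM2l ?normc_ge0.
Qed.

(** Constants independent of the exponent are lost by taking roots. *)
Lemma expr_le_const (x y K : R) : 0 <= x -> 0 <= y ->
  (forall k, x ^+ k <= K * y ^+ k) -> x <= y.
Proof.
move=> x0 y0 xy; rewrite leNgt; apply/negP => yx.
have [y_eq0|yn0] := eqVneq y 0.
  by have := xy 1%N; rewrite y_eq0 expr1 expr1 mulr0 leNgt -y_eq0 yx.
have yp : 0 < y by rewrite lt_neqAle eq_sym yn0.
have [q qE] : exists q, q = x / y - 1 by eexists.
have q0 : 0 < q by rewrite qE subr_gt0 ltr_pdivlMr // mul1r.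
have bern k : 1 + k%:R * q <= (1 + q) ^+ k.
  elim: k => [|k IH]; first by rewrite mul0r addr0 expr0.
  rewrite exprS -natr1; have : 0 <= k%:R * q ^+ 2 by rewrite mulr_ge0 // sqr_ge0.
  have : 0 <= q * ((1 + q) ^+ k - (1 + k%:R * q)) by rewrite mulr_ge0 ?subr_ge0 // ltW.
  lra.
have := archi_boundP (normr_ge0 (K / q)); set k := Num.bound _ => kP.
have := xy k; have xE : x = (1 + q) * y by rewrite qE addrC subrK divfK.
rewrite {1}xE exprMn ler_pM2r ?exprn_gt0 //; have := bern k.
have : K < k%:R * q by rewrite -ltr_pdivrMr //; apply: le_lt_trans kP; exact: ler_norm.
lra.
Qed.

(** The factor 2 of cauchy_estimate, applied to the powers of f, disappears. *)
Lemma cauchy_le f a (r M : R) : 0 < r ->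
  (forall w, normc (w - a) <= 2 * r -> derivable f w 1) ->
  (forall w, r <= normc (w - a) <= 2 * r -> normc (f w) <= M) ->
  normc (f a) <= M.
Proof.
move=> r0 df fM.
have M0 : 0 <= M.
  apply: le_trans (normc_ge0 _) (fM (a + r%:C) _).
  by rewrite addrC addKr normc_real gtr0_norm //; lra.
apply: (@expr_le_const _ _ 2) => [||k]; [exact: normc_ge0|exact: M0|].
rewrite -normcX; apply: (cauchy_estimate (f := fun w => f w ^+ k) r0) => w wr.
  by apply: derivable_exp; exact: df.
by rewrite normcX lerXn2r ?nnegrE ?normc_ge0 // fM.
Qed.

End cauchy_estimate.

(** * The maximum principle on discs *)

Section disc_max.
Context {R : realType}.
Local Notation C := R[i]^o.
Implicit Types (f g : C -> C) (p d z w a : C).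

Lemma continuous_normc : continuous (@normc R : C -> R).
Proof.
move=> z A /nbhs_ballP[e /= e0 eA]; apply/nbhs_normcP; exists e => // w wz.
apply: eA; rewrite -ball_normE /=.
have h1 := normc_triB w z; have h2 := normc_triB z w.
by rewrite normc_distC in h2; rewrite ltr_norml; apply/andP; split; lra.
Qed.

(** A closed subset of the image of a square of R * R. *)
Lemma compact_disc (c : C) (r : R) : compact [set z : C | normc (z - c) <= r].
Proof.
pose psi (q : R * R) : C := c + (q.1 +i* q.2).
pose box := `[- r, r]%classic `*` `[- r, r]%classic : set (R * R).
have psi_cont : continuous psi.
  move=> q A /nbhs_normcP[d d0 dA]; have d20 : 0 < d / 2 by lra.
  exists ([set x | `|q.1 - x| < d / 2], [set x | `|q.2 - x| < d / 2]).
    by split; apply: (nbhsx_ballx _ (d / 2)).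
  move=> [x y] [/= hx hy]; apply: dA; rewrite /psi /= opprD addrACA subrr add0r.
  apply: le_lt_trans (ler_normcReIm _) _ => /=.
  by rewrite distrC in hx; rewrite distrC in hy; lra.
have cbox : compact (psi @` box).
  apply: continuous_compact; first exact: continuous_subspaceT.
  by apply: compact_setX; exact: segment_compact.
apply: subclosed_compact cbox _.
  rewrite (_ : [set _ | _] = (fun z => normc (z - c)) @^-1` [set x | x <= r]) //.
  apply: closed_comp; last exact: closed_le.
  move=> z _.
  apply: (continuous_comp (f := fun w : C => w - c : C) (g := @normc R : C -> R)).
    by apply: derivable_continuous; exact: derivable_subr.
  exact: continuous_normc.
move=> z /= zr; exists (complex.Re (z - c), complex.Im (z - c)); last first.
  by rewrite /psi /=; case: (z) (c) => x y [u v]; simpc; rewrite !subrKC.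
split=> /=; rewrite in_itv /= -ler_norml.
  exact: le_trans (ler_normcRe _) zr.
exact: le_trans (ler_normcIm _) zr.
Qed.

Lemma disc_EVT (u : C -> R) (c : C) (r : R) : 0 <= r ->
  (forall z, normc (z - c) <= r -> {for z, continuous u}) ->
  exists2 z0, normc (z0 - c) <= r & forall z, normc (z - c) <= r -> u z <= u z0.
Proof.
move=> r0 cu; have [|||z0] := @compact_EVT_max C R u [set z | normc (z - c) <= r].
- by exists c; rewrite /= subrr normc0.
- exact: compact_disc.
- by apply: continuous_in_subspaceT => z /set_mem /=; exact: cu.
move=> /set_mem /= z0r z0max; exists z0 => // z zr.
by apply: z0max; rewrite mem_setE.
Qed.

(** Cauchy-Schwarz with its defect for (1, sqrt e x) and (1, sqrt e y):
    compared with the radial weight 1 + e |y|^2, the holomorphic weight 1 + e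
    x^* y is largest only at y = x. *)
Lemma weight_identity (e : R) (x y : R[i]) :
  normc (1 + e%:C * x^* * y) ^+ 2 =
  (1 + e * normc x ^+ 2) * (1 + e * normc y ^+ 2) - e * normc (y - x) ^+ 2.
Proof.
by rewrite !normc_sqr; case: x y => a b [u v] /=; simpc => /=; ring.
Qed.

Lemma continuous_weight f (e : R) (c z : C) : {for z, continuous f} ->
  {for z, continuous (fun w => normc (f w) ^+ 2 * (1 + e * normc (w - c) ^+ 2) : R)}.
Proof.
move=> fz.
have nf (h : C -> C) : {for z, continuous h} ->
    {for z, continuous (fun w => normc (h w) ^+ 2 : R)}.
  move=> hz; have nh : {for z, continuous (fun w => normc (h w) : R)}.
    by apply: (continuous_comp (f := h) (g := @normc R : C -> R)) => //;
      exact: continuous_normc.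
  exact: (continuousM nh nh).
have n2 : {for z, continuous (fun w => normc (w - c) ^+ 2 : R)}.
  by apply: (nf (fun w => w - c)); apply: derivable_continuous; exact: derivable_subr.
apply: (continuousM (s := fun w => normc (f w) ^+ 2 : R)
  (t := fun w => 1 + e * normc (w - c) ^+ 2 : R)); first exact: nf.
apply: (continuousD (f := fun=> 1 : R) (g := fun w => e * normc (w - c) ^+ 2 : R)).
  exact: cst_continuous.
apply: (continuousM (s := fun=> e : R)) n2.
exact: cst_continuous.
Qed.

(** Suppose |f z1| exceeds M. For small e, the function |f|^2 (1 + e |z -
    c|^2) still has an interior maximum point z0 on the disc. Multiplying f by
    1 + e (z0 - c)^* (z - c) gives, by weight_identity, a differentiable
    function whose modulus on an annulus around z0 is strictly below its
    modulus at z0, against cauchy_le. *)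
Lemma max_principle f (c : C) (r M : R) :
  (forall z, normc (z - c) <= r -> derivable f z 1) ->
  (forall z, normc (z - c) = r -> normc (f z) <= M) ->
  forall z, normc (z - c) <= r -> normc (f z) <= M.
Proof.
move=> df fM z1 z1r; rewrite leNgt; apply/negP => Mf.
have r0 : 0 <= r by apply: le_trans z1r; exact: normc_ge0.
have M0 : 0 <= M.
  apply: le_trans (normc_ge0 _) (fM (c + r%:C) _).
  by rewrite addrC addKr normc_real ger0_norm.
pose F1 := normc (f z1) ^+ 2.
have MF : M ^+ 2 < F1 by rewrite /F1 ltrXn2r ?nnegrE ?normc_ge0.
(* so small that M^2 (1 + e r^2) < |f z1|^2 *)
pose e := (F1 - M ^+ 2) / (2 * (M ^+ 2 * r ^+ 2) + 1).
have Mr0 : 0 <= M ^+ 2 * r ^+ 2 by rewrite mulr_ge0 // sqr_ge0.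
have e0 : 0 < e by rewrite /e divr_gt0; lra.
have eM : M ^+ 2 * (1 + e * r ^+ 2) < F1.
  have : e * (2 * (M ^+ 2 * r ^+ 2) + 1) = F1 - M ^+ 2 by rewrite divfK // gt_eqF; lra.
  by have := mulr_ge0 (ltW e0) Mr0; lra.
pose u w := normc (f w) ^+ 2 * (1 + e * normc (w - c) ^+ 2).
have [z0 z0r z0max] : exists2 z0, normc (z0 - c) <= r &
    forall z, normc (z - c) <= r -> u z <= u z0.
  apply: disc_EVT r0 _ => z zr; apply: continuous_weight.
  by apply: derivable_continuous; exact: df.
have F1u : F1 <= u z1 by rewrite /u ler_peMr ?sqr_ge0 // lerDl mulr_ge0 ?sqr_ge0 // ltW.
have u0M : M ^+ 2 * (1 + e * r ^+ 2) < u z0.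
  by apply: lt_le_trans eM (le_trans F1u (z0max _ z1r)).
have z0_int : normc (z0 - c) < r.
  rewrite lt_neqAle z0r andbT; apply: contraTneq u0M => z0_bd.
  rewrite -leNgt /u z0_bd ler_wpM2r //; first by rewrite addr_ge0 // mulr_ge0 ?sqr_ge0 ?ltW.
  by rewrite lerXn2r ?nnegrE ?normc_ge0 // fM.
pose rho := (r - normc (z0 - c)) / 2.
have rho0 : 0 < rho by rewrite /rho; lra.
pose A := normc (f z0) ^+ 2; pose B := 1 + e * normc (z0 - c) ^+ 2.
have B1 : 1 <= B by rewrite /B lerDl mulr_ge0 ?sqr_ge0 // ltW.
have AB0 : 0 < A * B.
  apply: le_lt_trans u0M.
  by rewrite mulr_ge0 ?sqr_ge0 // addr_ge0 // mulr_ge0 ?sqr_ge0 // ltW.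
pose h w : C := 1 + e%:C * (z0 - c)^* * (w - c).
have hE w : normc (h w) ^+ 2 = B * (1 + e * normc (w - c) ^+ 2) - e * normc (w - z0) ^+ 2.
  by rewrite weight_identity (_ : w - c - _ = w - z0) //; ring.
pose K := 1 + e * r ^+ 2.
have K1 : 1 <= K by rewrite /K lerDl mulr_ge0 ?sqr_ge0 // ltW.
have inside w : normc (w - z0) <= 2 * rho -> normc (w - c) <= r.
  move=> wz; rewrite (_ : w - c = (w - z0) + (z0 - c)); last by ring.
  by apply: le_trans (normcD _ _) _; move: wz; rewrite /rho; lra.
have : normc ((f z0 * h z0) ^+ 2) <= A * B * (B - e * rho ^+ 2 / K).
  apply: (cauchy_le (f := fun w => (f w * h w) ^+ 2) rho0) => w.
    move=> /inside wr; apply: derivable_exp; apply: derivable_mul; first exact: df.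
    apply: derivable_add; first exact: derivable_const.
    by apply: derivable_mul; [exact: derivable_const|exact: derivable_subr].
  case/andP => w1 /inside wr; rewrite normcX normcM exprMn hE.
  pose X := 1 + e * normc (w - c) ^+ 2; rewrite -/X.
  have X1 : 1 <= X by rewrite /X lerDl mulr_ge0 ?sqr_ge0 // ltW.
  have XK : X <= K.
    by rewrite /X /K lerD2l ler_pM2l // lerXn2r ?nnegrE ?normc_ge0.
  have FX : normc (f w) ^+ 2 <= A * B / X.
    by rewrite ler_pdivlMr; [exact: z0max|lra].
  have H0 : 0 <= B * X - e * normc (w - z0) ^+ 2 by rewrite -hE sqr_ge0.
  apply: le_trans (ler_wpM2r H0 FX) _.
  rewrite (_ : A * B / X * _ = A * B * (B - e * (normc (w - z0) ^+ 2 / X))); last first.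
    by field; rewrite gt_eqF //; lra.
  rewrite ler_pM2l // lerD2l lerN2 -mulrA ler_pM2l //.
  apply: ler_pM; rewrite ?sqr_ge0 ?invr_ge0 //; [lra| |].
    by rewrite lerXn2r ?nnegrE ?normc_ge0 // ltW.
  by rewrite lef_pV2 ?posrE //; lra.
rewrite normcX normcM exprMn hE subrr normc0 expr0n /= mulr0 subr0 -/A -/B.
rewrite mulrA ler_pM2l //; have : 0 < e * rho ^+ 2 / K.
  by rewrite divr_gt0 ?(lt_le_trans ltr01 K1) // mulr_gt0 // exprn_gt0.
lra.
Qed.

End disc_max.

Section exceptional_points.
Context {R : realType}.
Local Notation C := R[i]^o.
Implicit Types (f g q : C -> C) (p d z w a : C).

(** Multiplication by w - a turns continuity at a into differentiability at a. *)
Lemma derivable_subM f a : {for a, continuous f} ->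
  derivable (fun w => (w - a) * f w : C) a 1.
Proof.
move=> /continuous_normcP fa; apply/derivable_normcP; exists (f a) => e e0.
have [d d0 fd] := fa e e0; exists d => // w wa wd.
rewrite subrr mul0r subr0 mulrAC divff ?mul1r; first exact: fd.
by rewrite subr_eq0.
Qed.

Lemma derivable_prod_subr (E : seq C) z :
  derivable (fun w => \prod_(e <- E) (w - e) : C) z 1.
Proof.
elim: E => [|e E IH].
  rewrite (_ : (fun _ => _) = fun=> 1); first exact: derivable_const.
  by apply/funext => w; rewrite big_nil.
rewrite (_ : (fun _ => _) = fun w => (w - e) * \prod_(e0 <- E) (w - e0)).
  by apply: derivable_mul; [exact: derivable_subr|exact: IH].
by apply/funext => w; rewrite big_cons.
Qed.

Lemma derivable_prod_exc (E : seq C) f z : {for z, continuous f} ->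
  (z \notin E -> derivable f z 1) ->
  derivable (fun w => (\prod_(e <- E) (w - e)) * f w : C) z 1.
Proof.
move=> cf df; have [zE|zE] := boolP (z \in E); last first.
  by apply: derivable_mul; [exact: derivable_prod_subr|exact: df].
rewrite (_ : (fun _ => _) = fun w => (w - z) * ((\prod_(e <- rem z E) (w - e)) * f w)).
  apply: derivable_subM; apply: continuous_mul; last exact: cf.
  by apply: derivable_continuous; exact: derivable_prod_subr.
by apply/funext => w; rewrite (perm_big _ (perm_to_rem zE)) big_cons mulrA.
Qed.

Lemma seq_isolated (E : seq C) z :
  exists2 d : R, 0 < d & forall w, w != z -> normc (w - z) < d -> w \notin E.
Proof.
elim: E => [|e E [d d0 dE]]; first by exists 1.
have [->|ez] := eqVneq e z.
  by exists d => // w wz wd; rewrite inE negb_or wz dE.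
exists (Num.min d (normc (e - z))).
  by rewrite lt_min d0 normc_gt0 subr_eq0.
move=> w wz; rewrite lt_min => /andP[wd we]; rewrite inE negb_or dE // andbT.
by apply: contraTneq we => ->; rewrite ltxx.
Qed.

(** Finitely many points E where f is only continuous are harmless: the
    maximum principle holds for P f ^ k, where P is the product of the w - e,
    and the factor due to P is lost as k grows. *)
Lemma max_principle_exc (E : seq C) f (c : C) (r M : R) : 0 < r ->
  (forall z, normc (z - c) <= r -> {for z, continuous f}) ->
  (forall z, normc (z - c) <= r -> z \notin E -> derivable f z 1) ->
  (forall z, normc (z - c) = r -> normc (f z) <= M) ->
  forall z, normc (z - c) <= r -> normc (f z) <= M.
Proof.
move=> r0 cf df fM.
have M0 : 0 <= M.
  apply: le_trans (normc_ge0 _) (fM (c + r%:C) _).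
  by rewrite addrC addKr normc_real gtr0_norm.
pose P w : C := \prod_(e <- E) (w - e).
have off z : normc (z - c) <= r -> z \notin E -> normc (f z) <= M.
  move=> zr zE; have Pz : 0 < normc (P z).
    rewrite normc_gt0 /P prodf_seq_neq0; apply/allP => e eE /=.
    by rewrite subr_eq0; apply: contraNneq zE => ->.
  have [z1 _ z1P] : exists2 z1, normc (z1 - c) <= r &
      forall z, normc (z - c) <= r -> normc (P z) <= normc (P z1).
    apply: disc_EVT (ltW r0) _ => w _.
    apply: (continuous_comp (f := P) (g := @normc R : C -> R)).
      by apply: derivable_continuous; exact: derivable_prod_subr.
    exact: continuous_normc.
  apply: (@expr_le_const _ _ _ (normc (P z1) / normc (P z))) => [||k];
    [exact: normc_ge0|exact: M0|].
  rewrite mulrAC ler_pdivlMr // -normcX mulrC -normcM.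
  apply: (max_principle (f := fun w => P w * f w ^+ k) _ _ zr) => w wr.
    apply: derivable_prod_exc => [|wE]; last by apply: derivable_exp; exact: df.
    elim: (k) => [|j IH].
      rewrite (_ : (fun _ => _) = fun=> 1); first exact: cst_continuous.
      by apply/funext => v; rewrite expr0.
    rewrite (_ : (fun _ => _) = fun v => f v * f v ^+ j).
      by apply: continuous_mul; [exact: cf|exact: IH].
    by apply/funext => v; rewrite exprS.
  rewrite normcM normcX ler_pM ?exprn_ge0 ?normc_ge0 //.
    by apply: z1P; rewrite wr.
  by rewrite lerXn2r ?nnegrE ?normc_ge0 // fM.
move=> z zr; have [z_bd|z_bd] := eqVneq (normc (z - c)) r; first exact: fM.
have z_int : normc (z - c) < r by rewrite lt_neqAle z_bd.
rewrite leNgt; apply/negP => Mf.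
have [d1 d10 d1P] := seq_isolated E z.
have fM0 : 0 < normc (f z) - M by rewrite subr_gt0.
have /continuous_normcP/(_ _ fM0)[d2 d20 d2P] := cf z zr.
have d30 : 0 < r - normc (z - c) by rewrite subr_gt0.
pose t := Num.min d1 (Num.min d2 (r - normc (z - c))) / 2.
have t0 : 0 < t by rewrite divr_gt0 // !lt_min d10 d20 d30.
have tmin : t < Num.min d1 (Num.min d2 (r - normc (z - c))).
  by rewrite ltr_pdivrMr // ltr_pMr ?ltr1n // !lt_min d10 d20 d30.
move: tmin; rewrite !lt_min => /and3P[t1 t2 t3].
pose w : C := z + t%:C.
have wz : normc (w - z) = t by rewrite /w addrC addKr normc_real gtr0_norm.
have wr : normc (w - c) <= r.
  rewrite (_ : w - c = (w - z) + (z - c)); last by ring.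
  by apply: le_trans (normcD _ _) _; rewrite wz; lra.
have wE : w \notin E.
  by apply: d1P; rewrite ?wz // -subr_eq0 -normc_gt0 wz.
have := off w wr wE; have := d2P w; rewrite wz => /(_ t2).
have := normc_triB (f z) (f w); rewrite (normc_distC (f z)); lra.
Qed.

(** * Removable singularities *)

(** As in McShane's extension theorem, the limit of phi at a is the supremum
    of phi u - K |u - a|. *)
Lemma radial_limit (phi : C -> R) a (r K : R) : 0 < r ->
  (forall u v, u != a -> v != a -> normc (u - a) <= r -> normc (v - a) <= r ->
     phi u <= phi v + K * (normc (u - a) + normc (v - a))) ->
  exists S, forall u, u != a -> normc (u - a) <= r -> `|phi u - S| <= K * normc (u - a).
Proof.
move=> r0 phiK.
pose A := [set phi u - K * normc (u - a) | u in [set u | u != a /\ normc (u - a) <= r]].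
have A_ub v : v != a -> normc (v - a) <= r -> ubound A (phi v + K * normc (v - a)).
  by move=> va vr _ [u [ua ur] <-]; have := phiK u v ua va ur vr; lra.
have A0 : A !=set0.
  exists (phi (a + r%:C) - K * normc (a + r%:C - a)), (a + r%:C) => //.
  have ar : normc (a + r%:C - a) = r by rewrite addrC addKr normc_real gtr0_norm.
  by rewrite /= ar lexx -subr_eq0 -normc_gt0 ar.
exists (sup A) => u ua ur; rewrite ler_norml; apply/andP; split.
  by have := ge_sup A0 (A_ub u ua ur); lra.
have : phi u - K * normc (u - a) <= sup A.
  by apply: ub_le_sup; [exists (phi u + K * normc (u - a)); exact: A_ub|exists u].
lra.
Qed.

Lemma dquot_sym f u v : dquot f u v = dquot f v u.
Proof.
have [->//|uv] := eqVneq u v.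
by rewrite !dquotE // 1?eq_sym // -(opprB (f u)) -(opprB u) invrN mulrNN.
Qed.

(** Riemann's theorem, from the maximum principle. For u and v near a, the
    difference quotient of q at u and that of the latter at v are
    differentiable except at a, u, v, where they are continuous;
    max_principle_exc bounds them by their size on a fixed circle, uniformly
    in u and v. The value at a of the second one compares dquot q a u with
    dquot q u v, so that u |-> dquot q a u is Lipschitz near a and has a limit
    there. *)
Lemma derivable_removable q a (r : R) : 0 < r -> {for a, continuous q} ->
  (forall w, w != a -> normc (w - a) < r -> derivable q w 1) ->
  derivable q a 1.
Proof.
move=> r0 cqa dq; pose h := r / 2.
have h0 : 0 < h by rewrite /h; lra.
have dqh w : w != a -> normc (w - a) <= h -> derivable q w 1.
  by move=> wa wh; apply: dq wa _; move: wh; rewrite /h; lra.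
have cq w : normc (w - a) <= h -> {for w, continuous q}.
  have [->//|wa wh] := eqVneq w a.
  by apply: derivable_continuous; exact: dqh.
have [z1 _ qM] : exists2 z1, normc (z1 - a) <= h &
    forall z, normc (z - a) <= h -> normc (q z) <= normc (q z1).
  apply: disc_EVT (ltW h0) _ => w wh.
  by apply: (continuous_comp (f := q) (g := @normc R : C -> R));
    [exact: cq|exact: continuous_normc].
pose M := normc (q z1).
have small u v : normc (u - a) <= h / 2 -> normc (v - a) = h ->
    h / 2 <= normc (v - u) /\ v != u.
  move=> uh vh; have vu : h / 2 <= normc (v - u).
    have := normc_triB (v - a) (u - a); rewrite vh.
    by rewrite (_ : v - a - (u - a) = v - u); [lra|ring].
  by split=> //; rewrite -subr_eq0 -normc_gt0; lra.
have step (p : C -> C) u B : normc (u - a) <= h / 2 ->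
    (forall z, normc (z - a) <= h -> normc (p z) <= B) ->
    forall z, normc (z - a) = h -> normc (dquot p u z) <= 4 * B / h.
  move=> uh pB z zh; have [zu z_u] := small u z uh zh.
  rewrite dquotE // normcM normcV ler_pdivrMr; last by lra.
  have B0 : 0 <= B by apply: le_trans (normc_ge0 _) (pB z _); rewrite zh.
  have uh' : normc (u - a) <= h by lra.
  apply: (@le_trans _ _ (2 * B)).
    have := normcB (p z) (p u); have := pB u uh'.
    by have := pB z; rewrite zh lexx => /(_ isT); lra.
  have -> : 2 * B = 4 * B / h * (h / 2) by field; rewrite gt_eqF.
  by rewrite ler_wpM2l // divr_ge0 ?mulr_ge0 // ltW.
pose C1 := 4 * M / h.
have s_bound u : u != a -> normc (u - a) <= h / 2 ->
    forall z, normc (z - a) <= h -> normc (dquot q u z) <= C1.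
  move=> ua uh; have uh' : normc (u - a) <= h by lra.
  apply: (max_principle_exc (E := [:: a; u]) h0) => [z zh|z zh|].
  - have [->|zu] := eqVneq z u; first by apply: continuous_dquot_pole; exact: dqh.
    by apply: continuous_dquot zu _; exact: cq.
  - rewrite !inE negb_or => /andP[za zu].
    by apply: derivable_dquot zu _; exact: dqh.
  - exact: step uh qM.
pose C2 := 4 * C1 / h.
have t_bound u v : u != a -> normc (u - a) <= h / 2 -> v != a -> normc (v - a) <= h / 2 ->
    u != v -> normc (dquot (dquot q u) v a) <= C2.
  move=> ua uh va vh uv; have uh' : normc (u - a) <= h by lra.
  have vh' : normc (v - a) <= h by lra.
  have cs z : normc (z - a) <= h -> {for z, continuous (dquot q u)}.
    move=> zh; have [->|zu] := eqVneq z u.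
      by apply: continuous_dquot_pole; exact: dqh.
    by apply: continuous_dquot zu _; exact: cq.
  apply: (max_principle_exc (E := [:: a; u; v]) h0 (c := a)) => [z zh|z zh||].
  - have [->|zv] := eqVneq z v; last by apply: continuous_dquot zv _; exact: cs.
    by apply: continuous_dquot_pole; apply: derivable_dquot; [rewrite eq_sym|exact: dqh].
  - rewrite !inE !negb_or => /and3P[za zu zv].
    by apply: derivable_dquot zv _; apply: derivable_dquot zu _; exact: dqh.
  - exact: step vh (s_bound u ua uh).
  - by rewrite subrr normc0 ltW.
have lip u v : u != a -> v != a -> normc (u - a) <= h / 2 -> normc (v - a) <= h / 2 ->
    normc (dquot q a u - dquot q a v) <= C2 * (normc (u - a) + normc (v - a)).
  move=> ua va uh vh; have C20 : 0 <= C2.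
    have M0 : 0 <= M by exact: normc_ge0.
    by rewrite /C2 /C1 !(divr_ge0, mulr_ge0) // ltW.
  have [->|uv] := eqVneq u v.
    by rewrite subrr normc0 mulr_ge0 ?addr_ge0 ?normc_ge0.
  (* dquot q u v is symmetric in u and v: both quotients are compared with it *)
  have half x y : x != a -> y != a -> normc (x - a) <= h / 2 -> normc (y - a) <= h / 2 ->
      x != y -> normc (dquot q a x - dquot q x y) <= C2 * normc (y - a).
    move=> xa ya xh yh xy; have := t_bound x y xa xh ya yh xy.
    have ay : a != y by rewrite eq_sym.
    rewrite dquotE // normcM normcV ler_pdivrMr ?normc_gt0 ?subr_eq0 //.
    by rewrite (normc_distC a) (dquot_sym q a).
  have h1 := half u v ua va uh vh uv.
  have h2 := half v u va ua vh uh _; rewrite eq_sym in h2; have {}h2 := h2 uv.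
  rewrite (dquot_sym q v u) in h2.
  rewrite (_ : dquot q a u - dquot q a v = (dquot q a u - dquot q u v) -
    (dquot q a v - dquot q u v)); last by ring.
  by apply: le_trans (normcB _ _) _; lra.
have h20 : 0 < h / 2 by lra.
have lipRe u v : u != a -> v != a -> normc (u - a) <= h / 2 -> normc (v - a) <= h / 2 ->
    Re (dquot q a u) <= Re (dquot q a v) + C2 * (normc (u - a) + normc (v - a)).
  move=> ua va uh vh; have := le_trans (ler_normcRe _) (lip u v ua va uh vh).
  by case: (dquot q a u) (dquot q a v) => x y [x' y'] /=; rewrite ler_norml;
    move=> /andP[_]; lra.
have lipIm u v : u != a -> v != a -> normc (u - a) <= h / 2 -> normc (v - a) <= h / 2 ->
    Im (dquot q a u) <= Im (dquot q a v) + C2 * (normc (u - a) + normc (v - a)).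
  move=> ua va uh vh; have := le_trans (ler_normcIm _) (lip u v ua va uh vh).
  by case: (dquot q a u) (dquot q a v) => x y [x' y'] /=; rewrite ler_norml;
    move=> /andP[_]; lra.
have [S SP] := radial_limit h20 lipRe.
have [T TP] := radial_limit h20 lipIm.
apply/derivable_normcP; exists (S +i* T) => e e0.
have C20 : 0 < 2 * `|C2| + 1 by rewrite ltr_wpDl // mulr_ge0.
exists (Num.min (h / 2) (e / (2 * `|C2| + 1))); first by rewrite lt_min h20 divr_gt0.
move=> w wa; rewrite lt_min => /andP[w1 w2].
rewrite -dquotE //; apply: le_lt_trans (ler_normcReIm _) _.
have := SP w wa (ltW w1); have := TP w wa (ltW w1).
rewrite ltr_pdivlMr // in w2.
have : C2 * normc (w - a) <= `|C2| * normc (w - a).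
  by rewrite ler_wpM2r ?normc_ge0 ?ler_norm.
have := normc_ge0 (w - a).
by case: (dquot q a w) => x y /=; lra.
Qed.

Lemma derivable_dquot_pole f a (r : R) : 0 < r ->
  (forall w, normc (w - a) < r -> derivable f w 1) -> derivable (dquot f a) a 1.
Proof.
move=> r0 df; apply: (derivable_removable r0) => [|w wa wr].
  by apply: continuous_dquot_pole; apply: df; rewrite subrr normc0.
by apply: derivable_dquot wa _; exact: df.
Qed.

End exceptional_points.

(** * The Schwarz lemma *)

Section schwarz.
Context {R : realType}.
Local Notation C := R[i]^o.
Implicit Types (f g q F : C -> C) (z w a : C).

(** The Blaschke factor has modulus at most 1 on the closed disc and equal to
    1 on the circle because of this identity. *)
Lemma blaschke_identity z a :
  normc (1 - a^* * z) ^+ 2 =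
  normc (z - a) ^+ 2 + (1 - normc a ^+ 2) * (1 - normc z ^+ 2).
Proof.
by rewrite !normc_sqr; case: z a => x y [u v] /=; simpc => /=; ring.
Qed.

Lemma blaschke_denom_neq0 z a : normc z <= 1 -> normc a < 1 -> 1 - a^* * z != 0.
Proof.
move=> z1 a1; rewrite -normc_gt0; apply: lt_le_trans (normc_triB _ _).
rewrite normc1 subr_gt0 normcM normcJ; apply: le_lt_trans a1.
by rewrite ler_piMr ?normc_ge0.
Qed.

Definition blaschke a z : C := (z - a) / (1 - a^* * z).

Lemma blaschke_le1 z a : normc a < 1 -> normc z <= 1 -> normc (blaschke a z) <= 1.
Proof.
move=> a1 z1; have d0 := blaschke_denom_neq0 z1 a1.
rewrite /blaschke normcM normcV ler_pdivrMr ?normc_gt0 // mul1r.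
rewrite -(@ler_pXn2r _ 2) ?nnegrE ?normc_ge0 // blaschke_identity lerDl.
by rewrite mulr_ge0 // subr_ge0 expr_le1 ?normc_ge0 // ltW.
Qed.

Lemma blaschke_lt1 z a : normc a < 1 -> normc z < 1 -> normc (blaschke a z) < 1.
Proof.
move=> a1 z1; have d0 := blaschke_denom_neq0 (ltW z1) a1.
rewrite /blaschke normcM normcV ltr_pdivrMr ?normc_gt0 // mul1r.
rewrite -(@ltr_pXn2r _ 2) ?nnegrE ?normc_ge0 // blaschke_identity ltrDl.
by rewrite mulr_gt0 // subr_gt0 expr_lt1 ?normc_ge0.
Qed.

Lemma blaschke_circle z a : normc a < 1 -> normc z = 1 -> normc (blaschke a z) = 1.
Proof.
move=> a1 z1; have d0 : 1 - a^* * z != 0 by apply: blaschke_denom_neq0; rewrite ?z1.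
rewrite /blaschke normcM normcV; have -> : normc (z - a) = normc (1 - a^* * z).
  apply/eqP; rewrite -(@eqrXn2 _ 2) ?normc_ge0 // blaschke_identity z1.
  by rewrite expr1n subrr mulr0 addr0.
by rewrite divff // normc_eq0.
Qed.

Lemma derivable_blaschke_denom a z : derivable (fun w => 1 - a^* * w : C) z 1.
Proof.
apply: derivable_sub; first exact: derivable_const.
by apply: derivable_mul; [exact: derivable_const|exact: derivable_var].
Qed.

Lemma derivable_blaschke a z : 1 - a^* * z != 0 -> derivable (blaschke a) z 1.
Proof.
move=> d0; apply: (derivable_mul (f := fun w => w - a) (g := fun w => (1 - a^* * w)^-1)).
  exact: derivable_subr.
by apply: (derivable_inv (f := fun w => 1 - a^* * w) d0); exact: derivable_blaschke_denom.
Qed.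

(** The quotient of F by the Blaschke factor of a, when F a = 0, written so as
    to make sense at a. *)
Definition schur a F z : C := (1 - a^* * z) * dquot F a z.

Lemma schurE a F z : 1 - a^* * z != 0 -> F a = 0 -> F z = blaschke a z * schur a F z.
Proof.
move=> d0 Fa; have [->|za] := eqVneq z a; first by rewrite Fa /blaschke subrr !mul0r.
rewrite /schur dquotE // Fa subr0 /blaschke; field.
by rewrite d0 subr_eq0 za.
Qed.

Lemma disc_nbhd a : normc a < 1 ->
  exists2 r : R, 0 < r & forall w : C, normc (w - a) < r -> normc w < 1.
Proof.
move=> a1; exists (1 - normc a); first by rewrite subr_gt0.
by move=> w wa; have := normc_triB w a; lra.
Qed.

Lemma derivable_schur a F (r : R) z : 0 < r ->
  (forall w, normc (w - a) < r -> derivable F w 1) ->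
  derivable F z 1 -> derivable (schur a F) z 1.
Proof.
move=> r0 dF dz; apply: derivable_mul; first exact: derivable_blaschke_denom.
have [->|za] := eqVneq z a; first exact: derivable_dquot_pole r0 dF.
exact: derivable_dquot.
Qed.

(** On the circle of radius r < 1, blaschke_identity bounds the squared
    modulus by 1 + O(1 - r). The maximum principle carries the bound to the
    inside, and r tends to 1. *)
Lemma schur_le1 a F : normc a < 1 -> F a = 0 ->
  (forall z, normc z < 1 -> derivable F z 1) ->
  (forall z, normc z < 1 -> normc (F z) <= 1) ->
  forall z, normc z < 1 -> normc (schur a F z) <= 1.
Proof.
move=> a1 Fa dF F1 z z1.
have [s s0 sP] := disc_nbhd a1.
have dS w : normc w < 1 -> derivable (schur a F) w 1.
  by move=> w1; apply: (derivable_schur s0) (dF _ w1) => v /sP; exact: dF.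
have na0 := normc_ge0 a.
pose c := (1 - normc a) / 2.
have c0 : 0 < c by rewrite /c; lra.
rewrite -(@ler_pXn2r _ 2) ?nnegrE ?normc_ge0 // expr1n.
apply/ler_addgt0Pr => e e0.
(* r is large enough to enclose z, to keep the circle at distance c from a,
   and to have 1 - r^2 <= e c^2 *)
pose r := Num.max (normc z) (Num.max ((1 + normc a) / 2) (1 - e * c ^+ 2 / 2)).
have ec0 : 0 < e * c ^+ 2 by rewrite mulr_gt0 // exprn_gt0.
have r1 : r < 1 by rewrite !gt_max z1 /=; apply/andP; split; lra.
have zr : normc z <= r by rewrite le_max lexx.
have ar : (1 + normc a) / 2 <= r by rewrite !le_max lexx orbT.
have er : 1 - e * c ^+ 2 / 2 <= r by rewrite !le_max lexx !orbT.
rewrite -normcX.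
apply: (max_principle (f := fun w => schur a F w ^+ 2) (c := 0) (r := r)) => [w|w|].
- by rewrite subr0 => wr; apply: derivable_exp; apply: dS; apply: le_lt_trans r1.
- rewrite subr0 => wr; have w1 : normc w < 1 by rewrite wr.
  have wa : c <= normc (w - a) by have := normc_triB w a; rewrite wr /c; lra.
  have wa0 : 0 < normc (w - a) by lra.
  have wa' : w != a by rewrite -subr_eq0 -normc_gt0.
  rewrite normcX /schur dquotE // Fa subr0 !normcM normcV mulrA expr_div_n.
  rewrite ler_pdivrMr ?exprn_gt0 // exprMn blaschke_identity wr.
  apply: (@le_trans _ _ ((normc (w - a) ^+ 2 + e * normc (w - a) ^+ 2) * 1)); last by lra.
  have r20 : 0 <= 1 - r ^+ 2 by nra.
  have a20 : 0 <= 1 - normc a ^+ 2 by nra.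
  have ce : (1 - normc a ^+ 2) * (1 - r ^+ 2) <= e * normc (w - a) ^+ 2.
    apply: (@le_trans _ _ (e * c ^+ 2)); last first.
      by rewrite ler_pM2l // lerXn2r ?nnegrE // ltW.
    have r2 : 1 - r ^+ 2 <= e * c ^+ 2 by nra.
    by apply: le_trans r2; rewrite ler_piMl // lerBlDr lerDl sqr_ge0.
  apply: ler_pM; first by rewrite addr_ge0 ?sqr_ge0 // mulr_ge0.
  + exact: sqr_ge0.
  + by rewrite lerD2l.
  + by rewrite expr_le1 ?normc_ge0 // F1.
- by rewrite subr0.
Qed.

Lemma schwarz a F z : normc a < 1 -> F a = 0 ->
  (forall z, normc z < 1 -> derivable F z 1) ->
  (forall z, normc z < 1 -> normc (F z) <= 1) ->
  normc z < 1 -> normc (F z) <= normc (blaschke a z).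
Proof.
move=> a1 Fa dF F1 z1; rewrite (schurE (blaschke_denom_neq0 (ltW z1) a1) Fa) normcM.
by rewrite ler_piMr ?normc_ge0 //; exact: schur_le1.
Qed.

(** Let p = (q z0)^* q, so that p z0 = 1. For 0 < s < 1 the Schwarz lemma at
    z0 applies to s p followed by the Blaschke factor of s. When s tends to 1
    it becomes |p z - 1| <= |blaschke z0 z| |p z - 1|, where the factor is
    less than 1. *)
Lemma strong_max q z0 : normc z0 < 1 ->
  (forall z, normc z < 1 -> derivable q z 1) ->
  (forall z, normc z < 1 -> normc (q z) <= 1) ->
  normc (q z0) = 1 -> forall z, normc z < 1 -> q z = q z0.
Proof.
move=> z01 dq q1 qz0 z z1.
pose p w : C := (q z0)^* * q w.
have pz0 : p z0 = 1.
  have /eqP := normc_sqr (q z0); rewrite qz0 expr1n /p.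
  case: (q z0) => x y /=; simpc => /eqP e; rewrite -[1]/(1 +i* 0).
  by congr Complex; rewrite ?[RHS]e; ring.
have p1 w : normc w < 1 -> normc (p w) <= 1.
  by move=> w1; rewrite /p normcM normcJ qz0 mul1r q1.
have qp : q z = q z0 * p z.
  have : (q z0)^* * q z0 = 1 := pz0.
  by rewrite /p mulrA [q z0 * _]mulrC => ->; rewrite mul1r.
suff p_one : p z = 1 by rewrite qp p_one mulr1.
pose mu := normc (blaschke z0 z).
have mu1 : mu < 1 by exact: blaschke_lt1.
have mu0 : 0 <= mu by exact: normc_ge0.
pose d := normc (p z - 1).
have d0 : 0 <= d by exact: normc_ge0.
have key (t : R) : 0 < t < 1 -> (1 - t - mu) * d <= 2 * t.
  move=> /andP[t0 t1]; have [s sE] : exists s, s = 1 - t by eexists.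
  have s0 : 0 < s by rewrite sE; lra.
  have ns : normc s%:C = s by rewrite normc_real gtr0_norm.
  have s1 : normc s%:C < 1 by rewrite ns sE; lra.
  have sp w : normc w < 1 -> normc (s%:C * p w) <= 1.
    move=> w1; rewrite normcM ns; have := p1 w w1; have := normc_ge0 (p w).
    by rewrite sE; nra.
  pose F w := blaschke s%:C (s%:C * p w).
  have Fb w : normc w < 1 -> normc (F w) <= 1.
    by move=> w1; apply: blaschke_le1 s1 (sp w w1).
  have : normc (F z) <= mu.
    apply: schwarz z01 _ _ Fb z1; first by rewrite /F /blaschke pz0 mulr1 subrr mul0r.
    move=> w w1; have den := blaschke_denom_neq0 (sp w w1) s1.
    have dsp : derivable (fun v => s%:C * p v : C) w 1.
      apply: derivable_mul; first exact: derivable_const.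
      by apply: derivable_mul; [exact: derivable_const|exact: dq].
    apply: (derivable_mul (f := fun v => s%:C * p v - s%:C)
       (g := fun v => (1 - (s%:C)^* * (s%:C * p v))^-1)).
      by apply: derivable_sub; [exact: dsp|exact: derivable_const].
    apply: (derivable_inv (f := fun v => 1 - (s%:C)^* * (s%:C * p v)) den).
    apply: derivable_sub; first exact: derivable_const.
    by apply: derivable_mul; [exact: derivable_const|exact: dsp].
  rewrite /F /blaschke normcM normcV ler_pdivrMr; last first.
    by rewrite normc_gt0; exact: blaschke_denom_neq0 (sp z z1) s1.
  have cs : (s%:C)^* = s%:C by exact: conjc_real.
  rewrite cs (_ : s%:C * p z - s%:C = s%:C * (p z - 1)); last by ring.
  rewrite normcM ns -/d => h.
  have : normc (1 - s%:C * (s%:C * p z)) <= d + (1 - s ^+ 2).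
    rewrite (_ : 1 - _ = - (p z - 1) + (1 - s ^+ 2)%:C * p z); last first.
      by rewrite rmorphB rmorphXn rmorph1 /=; ring.
    apply: le_trans (normcD _ _) _; rewrite normc_opp lerD2l normcM normc_real.
    rewrite ger0_norm; last by rewrite sE; nra.
    by rewrite ler_piMr ?p1 //; rewrite sE; nra.
  have : 1 - s ^+ 2 <= 2 * t by rewrite sE; nra.
  rewrite -sE; move: h; move: (normc _) => X h h1 h2; nra.
apply/eqP; rewrite -subr_eq0 -normc_eq0 -/d.
rewrite eq_le d0 andbT leNgt; apply/negP => dp.
(* so small that key t fails if d > 0 *)
pose t := Num.min (1 / 2) ((1 - mu) * d / (2 * (2 + d))).
have den0 : 0 < 2 * (2 + d) by lra.
have num0 : 0 < (1 - mu) * d by rewrite mulr_gt0 // subr_gt0.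
have t0 : 0 < t by rewrite lt_min divr_gt0 // divr_gt0.
have t2 : t <= 1 / 2 by rewrite ge_min lexx.
have : t <= (1 - mu) * d / (2 * (2 + d)) by rewrite ge_min lexx orbT.
rewrite ler_pdivlMr // => t3.
have t01 : 0 < t < 1 by apply/andP; split; lra.
have := key t t01; lra.
Qed.

End schwarz.

Local Transparent derivable.

(** * Positive definite matrices *)

Section posdef.
Context {R : realType}.
Local Notation K := R[i].

Lemma adjM m n p (A : 'M[K]_(m, n)) (B : 'M[K]_(n, p)) :
  (A *m B)^t* = B^t* *m A^t*.
Proof. by rewrite trmx_mul map_mxM. Qed.

Lemma adjD m n (A B : 'M[K]_(m, n)) : (A + B)^t* = A^t* + B^t*.
Proof. by apply/matrixP => i j; rewrite !mxE rmorphD. Qed.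

Lemma adjN m n (A : 'M[K]_(m, n)) : (- A)^t* = - A^t*.
Proof. by apply/matrixP => i j; rewrite !mxE rmorphN. Qed.

Lemma adjB m n (A B : 'M[K]_(m, n)) : (A - B)^t* = A^t* - B^t*.
Proof. by rewrite adjD adjN. Qed.

Lemma adjK m n (A : 'M[K]_(m, n)) : A^t*^t* = A.
Proof. exact: trmxCK. Qed.

Lemma adj1 n : (1%:M : 'M[K]_n)^t* = 1%:M.
Proof. by rewrite trmx1 map_mx1. Qed.

Lemma adj0 m n : (0 : 'M[K]_(m, n))^t* = 0.
Proof. by rewrite trmx0 map_mx0. Qed.

Lemma adj_eq0 m n (A : 'M[K]_(m, n)) : (A^t* == 0) = (A == 0).
Proof. by apply/eqP/eqP => [h|->]; [rewrite -[A]adjK h|]; exact: adj0. Qed.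

Definition form m n (A : 'M[K]_(m, n)) (x : 'cV[K]_m) (y : 'cV[K]_n) : K :=
  (x^t* *m A *m y) 0 0.

Lemma form_mulr m n p (A : 'M[K]_(m, n)) (B : 'M[K]_(n, p)) x y :
  form (A *m B) x y = form A x (B *m y).
Proof. by rewrite /form !mulmxA. Qed.

Lemma form_mull m n p (A : 'M[K]_(m, n)) (B : 'M[K]_(n, p)) x y :
  form (A *m B) x y = form B (A^t* *m x) y.
Proof. by rewrite /form adjM adjK !mulmxA. Qed.

Lemma formD m n (A B : 'M[K]_(m, n)) x y : form (A + B) x y = form A x y + form B x y.
Proof. by rewrite /form mulmxDr mulmxDl mxE. Qed.

Lemma formN m n (A : 'M[K]_(m, n)) x y : form (- A) x y = - form A x y.
Proof. by rewrite /form mulmxN mulNmx mxE. Qed.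

Lemma formZ m n c (A : 'M[K]_(m, n)) x y : form (c *: A) x y = c * form A x y.
Proof. by rewrite /form -scalemxAr -scalemxAl mxE. Qed.

Lemma formDr m n (A : 'M[K]_(m, n)) x y z : form A x (y + z) = form A x y + form A x z.
Proof. by rewrite /form mulmxDr mxE. Qed.

Lemma formZr m n (A : 'M[K]_(m, n)) x c y : form A x (c *: y) = c * form A x y.
Proof. by rewrite /form -scalemxAr mxE. Qed.

Lemma form_conj m n (A : 'M[K]_(m, n)) x y : (form A x y)^* = form (A^t*) y x.
Proof.
rewrite /form; have -> : y^t* *m A^t* *m x = (x^t* *m A *m y)^t*.
  by rewrite !adjM adjK mulmxA.
by rewrite !mxE.
Qed.

Definition herm_pos n (A : 'M[K]_n) := A^t* = A /\ posdefmx A.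

Definition qform n (A : 'M[K]_n) (x : 'cV[K]_n) : R := Re (form A x x).

Lemma qformE n (A : 'M[K]_n) x : A^t* = A -> form A x x = (qform A x)%:C.
Proof.
move=> hA; have := form_conj A x x; rewrite hA /qform.
case: (form A x x) => u v [/esym h]; congr Complex; lra.
Qed.

Lemma posdefmxP n (A : 'M[K]_n) : A^t* = A ->
  posdefmx A <-> (forall x, x != 0 -> 0 < qform A x).
Proof.
move=> hA; have lt0 (r : R) : (0 < r%:C :> K) = (0 < r) by exact: (ltcR 0 r).
split=> pA x x0; first by have := pA x x0; rewrite -/(form A x x) qformE // lt0.
by rewrite -/(form A x x) qformE // lt0; exact: pA.
Qed.

Lemma qformD n (A B : 'M[K]_n) x : qform (A + B) x = qform A x + qform B x.
Proof. by rewrite /qform formD ReD. Qed.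

Lemma qformB n (A B : 'M[K]_n) x : qform (A - B) x = qform A x - qform B x.
Proof. by rewrite /qform formD ReD formN; case: (form B x x). Qed.

Lemma qform_conj m n (A : 'M[K]_n) (B : 'M[K]_(m, n)) x :
  qform (B *m A *m B^t*) x = qform A (B^t* *m x).
Proof. by rewrite /qform form_mulr form_mull. Qed.

Lemma qform0 n (A : 'M[K]_n) : qform A 0 = 0.
Proof. by rewrite /qform /form mulmx0 mxE. Qed.

Lemma qform_gt0 n (A : 'M[K]_n) x : herm_pos A -> x != 0 -> 0 < qform A x.
Proof. by move=> [hA pA]; exact: (posdefmxP hA).1. Qed.

Lemma qform_ge0 n (A : 'M[K]_n) x : herm_pos A -> 0 <= qform A x.
Proof.
move=> pA; have [->|x0] := eqVneq x 0; first by rewrite qform0.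
by rewrite ltW // qform_gt0.
Qed.

(** The form at x + c y is nonnegative; the choice c = - b^* / qform A y, with b =
    form A x y, minimises it. *)
Lemma cauchy_schwarz n (A : 'M[K]_n) x y : herm_pos A ->
  normc (form A x y) ^+ 2 <= qform A x * qform A y.
Proof.
move=> pA; have [hA _] := pA.
have [->|y0] := eqVneq y 0.
  by rewrite qform0 mulr0 /form mulmx0 mxE normc0 expr0n.
have qy := qform_gt0 pA y0.
pose b := form A x y; pose c : K := - b^* / (qform A y)%:C.
have qy0 : (qform A y)%:C != 0 :> K.
  by apply/eqP => -[h]; rewrite h ltxx in qy.
have form_Dl u v w : form A (u + v) w = form A u w + form A v w.
  by rewrite -[LHS]conjCK form_conj hA formDr rmorphD /= !form_conj hA.
have form_Zl k u w : form A (k *: u) w = k^* * form A u w.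
  by rewrite -[LHS]conjCK form_conj hA formZr rmorphM /= !form_conj hA.
have byx : form A y x = b^* by rewrite /b form_conj hA.
have qJ : ((qform A y)%:C : K)^* = (qform A y)%:C by exact: conjc_real.
have expand : form A (x + c *: y) (x + c *: y) =
    (qform A x)%:C - b * b^* / (qform A y)%:C.
  rewrite !(formDr, formZr, form_Dl, form_Zl) byx -/b !(qformE _ hA).
  rewrite /c rmorphM rmorphN /= fmorphV /= conjCK qJ; field.
  exact: qy0.
have := qform_ge0 (x + c *: y) pA; rewrite {1}/qform expand.
have -> : b * b^* = (normc b ^+ 2)%:C.
  by rewrite normc_sqr; case: (b) => u v; simpc; congr Complex; ring.
rewrite -fmorphV -rmorphM -rmorphB /= subr_ge0 ler_pdivrMr //.
Qed.

Lemma herm_pos1 n : herm_pos (1%:M : 'M[K]_n).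
Proof.
split; first exact: adj1.
move=> x x0; rewrite mulmx1 mxE lt_neqAle; apply/andP; split.
  rewrite eq_sym psumr_neq0 => [|i _]; last by rewrite !mxE mulrC mul_conjC_ge0.
  have [i xi] : exists i, x i 0 != 0.
    by apply/existsP; apply: contraR x0; rewrite negb_exists => /forallP x0;
      apply/eqP/matrixP => i j; rewrite ord1 mxE; apply/eqP; have := x0 i; rewrite negbK.
  by apply/hasP; exists i; rewrite ?mem_index_enum //= !mxE mulrC mul_conjC_gt0.
by apply: sumr_ge0 => i _; rewrite !mxE mulrC mul_conjC_ge0.
Qed.

Lemma posdefmx_unit n (A : 'M[K]_n) : posdefmx A -> A \in unitmx.
Proof.
move=> pA; rewrite -row_free_unit -kermx_eq0; apply: contraT.
move=> /rowV0Pn[u /sub_kermxP uA u0].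
have := pA (u^t*); rewrite adj_eq0 => /(_ u0).
by rewrite adjK uA mul0mx mxE ltxx.
Qed.

Lemma posdefmx_conj n (A N : 'M[K]_n) : N \in unitmx ->
  posdefmx A -> posdefmx (N *m A *m N^t*).
Proof.
move=> uN pA x x0; have y0 : N^t* *m x != 0.
  rewrite -adj_eq0 adjM adjK; apply: contraNneq x0 => xN.
  by rewrite -adj_eq0 -[x^t*](mulmxK uN) xN mul0mx.
by have := pA _ y0; rewrite adjM adjK !mulmxA.
Qed.

Lemma posdefmx_conjV n (A N : 'M[K]_n) : N \in unitmx ->
  posdefmx (N *m A *m N^t*) -> posdefmx A.
Proof.
move=> uN pA; have uN' : invmx N \in unitmx by rewrite unitmx_inv.
have := posdefmx_conj uN' pA.
rewrite (_ : invmx N *m (N *m A *m N^t*) *m (invmx N)^t* = A) //.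
by rewrite !mulmxA (mulVmx uN) mul1mx -mulmxA -adjM (mulVmx uN) adj1 mulmx1.
Qed.

Lemma adj_inv n (A : 'M[K]_n) : (invmx A)^t* = invmx (A^t*).
Proof. by rewrite trmx_inv map_invmx. Qed.

Lemma herm_pos_inv n (A : 'M[K]_n) : herm_pos A -> herm_pos (invmx A).
Proof.
move=> [hA pA]; have uA := posdefmx_unit pA.
have hV : (invmx A)^t* = invmx A by rewrite adj_inv hA.
split; first exact: hV.
have uV : invmx A \in unitmx by rewrite unitmx_inv.
by have := posdefmx_conj uV pA; rewrite hV (mulVmx uA) mul1mx.
Qed.

End posdef.

(** * Matrix balls and their Moebius maps *)

Section ball.
Context {R : realType}.
Local Notation K := R[i].
Variables (n m : nat).
Implicit Types (P : 'M[K]_n) (S : 'M[K]_m) (z w a : 'M[K]_(n, m)).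

(** The image of the matrix ball under z |-> P^(1/2) z S^(-1/2). The whole
    family is considered at once because it is stable under Moebius maps that
    are rational in P, S and the base point; staying in one ball would require
    square roots of matrices. *)
Definition gball P S : set 'M[K]_(n, m) := [set z | posdefmx (P - z *m S *m z^t*)].

Lemma gball_herm P S z : P^t* = P -> S^t* = S ->
  (P - z *m S *m z^t*)^t* = P - z *m S *m z^t*.
Proof. by move=> hP hS; rewrite adjB !adjM adjK hP hS mulmxA. Qed.

Lemma gballP P S z : herm_pos P -> herm_pos S ->
  gball P S z <-> forall x, x != 0 -> qform S (z^t* *m x) < qform P x.
Proof.
move=> [hP _] [hS _]; rewrite /gball /= posdefmxP; last exact: gball_herm.
by split=> h x /h; rewrite qformB qform_conj subr_gt0.
Qed.

(** By Cauchy-Schwarz the ball is cut out by conditions on the moduli of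
    linear functionals of z; through them scalar function theory applies to
    it. *)
Lemma gball_form P S z : herm_pos P -> herm_pos S ->
  gball P S z <-> forall x y, x != 0 -> y != 0 ->
    normc (form (z *m S) x y) ^+ 2 < qform P x * qform S y.
Proof.
move=> pP pS; rewrite gballP //; split=> [zb x y x0 y0|zb x x0].
  rewrite form_mull; apply: le_lt_trans (cauchy_schwarz _ _ pS) _.
  by rewrite ltr_pM2r ?zb // qform_gt0.
have [->|y0] := eqVneq (z^t* *m x) 0; first by rewrite qform0 qform_gt0.
have := zb x _ x0 y0; rewrite form_mull qformE; last by case: pS.
rewrite normc_real gtr0_norm ?qform_gt0 // expr2 ltr_pM2r //.
by rewrite qform_gt0.
Qed.

Section moebius.
Variables (P : 'M[K]_n) (S : 'M[K]_m) (a : 'M[K]_(n, m)).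
Hypotheses (pP : herm_pos P) (pS : herm_pos S) (a_in : gball P S a).

Let P0 := P - a *m S *m a^t*.

(** The Moebius map with base point a is z |-> (P - z S a^* )^-1 (z - a). It
    sends a to 0 and gball P S onto gball G H, where G = (P - a S a^* )^-1 and
    H = S + S a^* G a S. Its inverse is w |-> a + G^-1 (1 + w S a^* )^-1 w. The
    two denominators moebN z and moebM w have product G^-1 when z and w
    correspond to each other. *)
Definition moebG := invmx P0.
Definition moebH := S + S *m a^t* *m moebG *m a *m S.
Definition moebN z := P0 - (z - a) *m S *m a^t*.
Definition moebM w := 1%:M + w *m S *m a^t*.

(** Cramer's formula: unlike invmx, an expression without case distinction,
    rational in the entries. *)
Definition adjinv k (A : 'M[K]_k) := (\det A)^-1 *: \adj A.

Definition moeb z := adjinv (moebN z) *m (z - a).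
Definition moebV w := a + P0 *m adjinv (moebM w) *m w.

Lemma adjinvE k (A : 'M[K]_k) : A \in unitmx -> adjinv A = invmx A.
Proof. by move=> uA; rewrite /invmx uA. Qed.

Lemma moebP0_pos : herm_pos P0.
Proof. by split; [apply: gball_herm; [case: pP|case: pS]|]. Qed.

Lemma moebP0_unit : P0 \in unitmx. Proof. by apply: posdefmx_unit; case: moebP0_pos. Qed.

Lemma moebG_pos : herm_pos moebG. Proof. exact: herm_pos_inv moebP0_pos. Qed.

Lemma moebH_q y : qform moebH y = qform S y + qform moebG (a *m S *m y).
Proof.
have [hS _] := pS.
rewrite /moebH qformD; congr (_ + _).
rewrite (_ : S *m a^t* *m moebG *m a *m S = (S *m a^t*) *m moebG *m (S *m a^t*)^t*).
  by rewrite qform_conj adjM adjK hS.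
by rewrite adjM adjK hS !mulmxA.
Qed.

Lemma moebH_pos : herm_pos moebH.
Proof.
have [hS _] := pS; have [hG _] := moebG_pos.
have hH : moebH^t* = moebH by rewrite /moebH adjD !adjM adjK hS hG !mulmxA.
split; first exact: hH.
apply/(posdefmxP hH) => y y0; rewrite moebH_q.
by apply: ltr_wpDr; [exact: qform_ge0 moebG_pos|exact: qform_gt0 pS y0].
Qed.

Lemma moebN_E z : moebN z = P - z *m S *m a^t*.
Proof. by rewrite /moebN /P0 !mulmxBl opprB addrA addrNK. Qed.

(** If u annihilates the denominator P - z S a^* from the left, then x = u^*
    has qform P x equal to the S-form of z^* x and a^* x. For z and a in the ball
    Cauchy-Schwarz makes this form smaller than qform P x. *)
Lemma moebN_unit z : gball P S z -> moebN z \in unitmx.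
Proof.
move=> z_in; rewrite -row_free_unit -kermx_eq0; apply: contraT.
move=> /rowV0Pn[u /sub_kermxP uN u0].
pose x := u^t*; have x0 : x != 0 by rewrite adj_eq0.
have hS : S^t* = S by case: pS.
have xP : form P x x = form S (z^t* *m x) (a^t* *m x).
  rewrite -form_mull -form_mulr; apply/eqP; rewrite -subr_eq0 -formN -formD.
  by rewrite -moebN_E /form adjK uN mul0mx mxE.
have := cauchy_schwarz (z^t* *m x) (a^t* *m x) pS; rewrite -xP qformE; last by case: pP.
rewrite normc_real real_normK ?num_real // leNgt => /negP; case.
have qz := (gballP z pP pS).1 z_in x x0; have qa := (gballP a pP pS).1 a_in x x0.
by apply: ltr_pM qz qa; exact: qform_ge0.
Qed.

(** With y = z - a and P0 = P - a S a^*, both sides equal P0 - y S a^* - a S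
    y^* - y S y^*, since moebN z = P0 - y S a^* and P0 G = 1. The ball
    conditions on z and on its image w thus differ by a congruence. *)
Lemma moeb_identity z w : moebN z *m w = z - a ->
  moebN z *m (moebG - w *m moebH *m w^t*) *m (moebN z)^t* = P - z *m S *m z^t*.
Proof.
have [hS _] := pS; have [hP0 _] := moebP0_pos; have [hG _] := moebG_pos.
move=> Nw; rewrite mulmxBr mulmxBl.
have -> : moebN z *m (w *m moebH *m w^t*) *m (moebN z)^t* =
    (z - a) *m moebH *m (z - a)^t* by rewrite -Nw adjM !mulmxA.
have [y yE] : exists y, y = z - a by exists (z - a).
have zE : z = y + a by rewrite yE subrK.
rewrite /moebN -yE [in RHS]zE.
have PG : P0 *m moebG = 1%:M by exact: mulmxV moebP0_unit.
have GP : moebG *m P0 = 1%:M by exact: mulVmx moebP0_unit.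
pose X := y *m S *m a^t*; pose X' := a *m S *m y^t*.
have -> : (P0 - y *m S *m a^t*)^t* = P0 - X' by rewrite adjB !adjM adjK hS hP0 !mulmxA.
have -> : P = P0 + a *m S *m a^t* by rewrite /P0 subrK.
have e1 : (P0 - X) *m moebG *m (P0 - X') = P0 - X - X' + X *m moebG *m X'.
  rewrite mulmxBl PG mulmxBr mulmxBl mul1mx -mulmxA GP mulmx1 mulmxBl mul1mx.
  move: (P0) (X *m _ *m _) => A B; clear; move: X X' => Y Y'.
  by apply/matrixP => i j; rewrite !mxE; ring.
have e2 : y *m moebH *m y^t* = y *m S *m y^t* + X *m moebG *m X'.
  by rewrite /moebH mulmxDr mulmxDl /X /X' !mulmxA.
have e3 : (y + a) *m S *m (y + a)^t* = y *m S *m y^t* + X + X' + a *m S *m a^t*.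
  rewrite adjD !mulmxDr !mulmxDl -/X -/X'.
  move: (y *m S *m y^t*) (a *m S *m a^t*) => A B; clear; move: X X' => Y Y'.
  by apply/matrixP => i j; rewrite !mxE; ring.
rewrite e1 e2 e3; move: (P0) (X) (X') (X *m _ *m _) (y *m _ *m _) (a *m _ *m _).
by move=> A1 A2 A3 A4 A5 A6; apply/matrixP => i j; rewrite !mxE; ring.
Qed.

Lemma moeb0 : moeb a = 0.
Proof. by rewrite /moeb subrr mulmx0. Qed.

Lemma moebV0 : moebV 0 = a.
Proof. by rewrite /moebV mulmx0 addr0. Qed.

Lemma moeb_in z : gball P S z -> gball moebG moebH (moeb z).
Proof.
move=> z_in; have uN := moebN_unit z_in.
have := moeb_identity (z := z) (w := moeb z).
rewrite /moeb (adjinvE uN) (mulKVmx uN) => /(_ erefl) h.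
by apply: (posdefmx_conjV uN); rewrite h.
Qed.

(** If u = - u w S a^* and x = u^*, then the G-form at x is the form of S a^*
    G a S = H - S at w^* x, hence at most the H-form there. In the ball the
    latter is below the G-form at x. *)
Lemma moebM_unit w : gball moebG moebH w -> moebM w \in unitmx.
Proof.
move=> w_in; rewrite -row_free_unit -kermx_eq0; apply: contraT.
move=> /rowV0Pn[u /sub_kermxP uM u0].
pose x := u^t*; have x0 : x != 0 by rewrite adj_eq0.
have hS : S^t* = S by case: pS.
have := (gballP w moebG_pos moebH_pos).1 w_in x x0.
have -> : qform moebG x = qform moebG (a *m S *m (w^t* *m x)).
  have uE : u = - (u *m w *m S *m a^t*).
    by apply/eqP; rewrite -addr_eq0 -!mulmxA -{1}[u]mulmx1 -mulmxDr !mulmxA uM.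
  have xE : x = - (a *m S *m (w^t* *m x)).
    by rewrite /x {1}uE adjN !adjM adjK hS !mulmxA.
  rewrite {1}xE /qform /form; congr Re.
  by rewrite adjN mulNmx mulmxN mulNmx opprK.
by rewrite moebH_q ltNge lerDr qform_ge0.
Qed.

Lemma moebV_sub w : moebV w - a = P0 *m adjinv (moebM w) *m w.
Proof. by rewrite /moebV addrC addKr. Qed.

Lemma moebN_moebV w : moebM w \in unitmx ->
  moebN (moebV w) = P0 *m invmx (moebM w).
Proof.
move=> uM; rewrite /moebN moebV_sub (adjinvE uM).
have eM : w *m S *m a^t* = moebM w - 1%:M by rewrite /moebM addrC addKr.
have -> : P0 *m invmx (moebM w) *m w *m S *m a^t* =
    P0 *m (invmx (moebM w) *m (w *m S *m a^t*)) by rewrite !mulmxA.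
by rewrite eM mulmxBr (mulVmx uM) mulmx1 mulmxBr mulmx1 opprB addrC subrK.
Qed.

Lemma moebV_in w : gball moebG moebH w -> gball P S (moebV w).
Proof.
move=> w_in; have uM := moebM_unit w_in.
have Nw : moebN (moebV w) *m w = moebV w - a.
  by rewrite (moebN_moebV uM) moebV_sub (adjinvE uM).
rewrite /gball /= -(moeb_identity Nw); apply: posdefmx_conj => //.
by rewrite (moebN_moebV uM) unitmx_mul moebP0_unit unitmx_inv.
Qed.

Lemma moebK z : gball P S z -> moebV (moeb z) = z.
Proof.
move=> z_in; have uN := moebN_unit z_in.
have uM := moebM_unit (moeb_in z_in).
rewrite /moebV (adjinvE uM).
have NM : moebN z *m moebM (moeb z) = P0.
  rewrite /moebM mulmxDr mulmx1 /moeb (adjinvE uN) !mulmxA (mulmxV uN) mul1mx.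
  by rewrite /moebN subrK.
rewrite -{1}NM (mulmxK uM) /moeb (adjinvE uN) mulmxA (mulmxV uN) mul1mx addrC subrK //.
Qed.

End moebius.
End ball.

(** * Matrix-valued maps *)

(** Names the normed structure that matrices have as a value of cartan_space. *)
Definition mxspace (R : realType) p q : normedModType R[i] := 'M[R[i]]_(p, q).

Section matrix_maps.
Context {R : realType}.
Local Notation K := R[i].
Local Notation C := R[i]^o.

Lemma nbhs_mxP p q (A : 'M[K]_(p, q)) (X : set 'M[K]_(p, q)) :
  nbhs (A : mxspace R p q) X <-> exists2 d : R, 0 < d &
    forall B : 'M[K]_(p, q), (forall i j, normc (B i j - A i j) < d) -> X B.
Proof.
split=> [/nbhs_ballP[e /= e0 AX]|[d d0 dX]].
  have e_real : e = (Re e)%:C by rewrite RRe_real // gtr0_real.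
  exists (Re e) => [|B AB]; first by rewrite -ltcR -e_real.
  apply: AX; split=> // i j; rewrite -ball_normE /= distrC norm_normc e_real ltcR.
  exact: AB.
apply/nbhs_ballP; exists d%:C => [/=|B [_ AB]]; first by rewrite ltcR.
apply: dX => i j; have := AB i j; rewrite -ball_normE /= distrC norm_normc ltcR; exact.
Qed.

Lemma derivable_mx p q (M : C -> 'M[K]_(p, q)) (t : C) :
  derivable (M : C -> mxspace R p q) t 1 <->
  forall i j, derivable (fun x => M x i j : C) t 1.
Proof.
split=> [/cvg_ex[/= L ML] i j|dM].
  apply/derivable_normcP; exists (L i j) => e e0.
  have /ML/dnbhs0P[d d0 dP] : nbhs (L : mxspace R p q) [set B : 'M[K]_(p, q) |
      forall i j, normc (B i j - L i j) < e].
    by apply/nbhs_mxP; exists e.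
  exists d => // w wt wd; have /= := dP (w - t).
  rewrite subr_eq0 => /(_ wt wd i j); rewrite [_ *: 1]mulr1 subrK !mxE.
  by rewrite [_ * (M _ _ _ - _)]mulrC.
apply/cvg_ex; exists (\matrix_(i, j) 'D_1 (fun x => M x i j : C) t) => X /nbhs_mxP[e e0 eX].
apply/dnbhs0P.
have [d d0 dP] : exists2 d : R, 0 < d & forall ij : 'I_p * 'I_q, forall w : C, w != t ->
    normc (w - t) < d -> normc ((M w ij.1 ij.2 - M t ij.1 ij.2) / (w - t) -
      'D_1 (fun x => M x ij.1 ij.2 : C) t) < e.
  suff [d d0 dP] : exists2 d : R, 0 < d & forall ij : 'I_p * 'I_q,
      ij \in enum {: 'I_p * 'I_q} -> forall w : C, w != t ->
    normc (w - t) < d -> normc ((M w ij.1 ij.2 - M t ij.1 ij.2) / (w - t) -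
      'D_1 (fun x => M x ij.1 ij.2 : C) t) < e.
    by exists d => // ij; apply: dP; rewrite mem_enum.
  elim: (enum _) => [|ij s [d d0 dP]]; first by exists 1.
  have [d' d'0 d'P] := derive_normc (dM ij.1 ij.2) e0.
  exists (Num.min d d'); first by rewrite lt_min d0.
  move=> ij'; rewrite inE => /orP[/eqP ->|ij's] w wt; rewrite lt_min => /andP[w1 w2].
    exact: d'P.
  exact: dP.
exists d => // h h0 hd; apply: eX => i j; rewrite !mxE /= [_ *: 1]mulr1.
have ht : h + t != t by rewrite -subr_eq0 addrK.
have := dP (i, j) (h + t) ht; rewrite addrK => /(_ hd) /=.
by rewrite [_^-1 * _]mulrC.
Qed.

Lemma derivable_bigsum (I : Type) (r : seq I) (f : I -> C -> C) (t : C) :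
  (forall i, derivable (f i) t 1) -> derivable (fun x => \sum_(i <- r) f i x : C) t 1.
Proof.
move=> df; elim: r => [|i r IH].
  rewrite (_ : (fun _ => _) = fun=> 0); first exact: derivable_const.
  by apply/funext => x; rewrite big_nil.
rewrite (_ : (fun _ => _) = fun x => f i x + \sum_(i <- r) f i x).
  by apply: derivable_add; [exact: df|exact: IH].
by apply/funext => x; rewrite big_cons.
Qed.

Lemma derivable_bigprod (I : Type) (r : seq I) (f : I -> C -> C) (t : C) :
  (forall i, derivable (f i) t 1) -> derivable (fun x => \prod_(i <- r) f i x : C) t 1.
Proof.
move=> df; elim: r => [|i r IH].
  rewrite (_ : (fun _ => _) = fun=> 1); first exact: derivable_const.
  by apply/funext => x; rewrite big_nil.
rewrite (_ : (fun _ => _) = fun x => f i x * \prod_(i <- r) f i x).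
  by apply: derivable_mul; [exact: df|exact: IH].
by apply/funext => x; rewrite big_cons.
Qed.

Lemma derivable_mulmx p q s (A : C -> 'M[K]_(p, q)) (B : C -> 'M[K]_(q, s)) (t : C) :
  derivable (A : C -> mxspace R p q) t 1 -> derivable (B : C -> mxspace R q s) t 1 ->
  derivable (fun x => A x *m B x : mxspace R p s) t 1.
Proof.
move=> /derivable_mx dA /derivable_mx dB; apply/derivable_mx => i j.
rewrite (_ : (fun _ => _) = fun x => \sum_k A x i k * B x k j).
  by apply: derivable_bigsum => k; apply: derivable_mul; [exact: dA|exact: dB].
by apply/funext => x; rewrite mxE.
Qed.

Lemma derivable_det p (A : C -> 'M[K]_p) (t : C) :
  derivable (A : C -> mxspace R p p) t 1 -> derivable (fun x => \det (A x) : C) t 1.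
Proof.
move=> /derivable_mx dA; rewrite /determinant.
apply: derivable_bigsum => s; apply: derivable_mul; first exact: derivable_const.
by apply: derivable_bigprod => i; exact: dA.
Qed.

Lemma derivable_adjinv p (A : C -> 'M[K]_p) (t : C) : A t \in unitmx ->
  derivable (A : C -> mxspace R p p) t 1 ->
  derivable (fun x => adjinv (A x) : mxspace R p p) t 1.
Proof.
move=> uA dA; apply/derivable_mx => i j.
rewrite (_ : (fun _ => _) = fun x =>
    (\det (A x))^-1 * ((-1) ^+ (j + i) * \det (row' j (col' i (A x))))); last first.
  by apply/funext => x; rewrite !mxE.
apply: derivable_mul.
  apply: (derivable_inv (f := fun x => \det (A x))); last exact: derivable_det.
  by rewrite -unitfE -unitmxE.
apply: derivable_mul; first exact: derivable_const.
apply: (derivable_det (A := fun x => row' j (col' i (A x)))).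
move/derivable_mx : dA => dA; apply/derivable_mx => k l.
rewrite (_ : (fun _ => _) = fun x => A x (lift j k) (lift i l)); first exact: dA.
by apply/funext => x; rewrite !mxE.
Qed.

Lemma normc_sum (I : Type) (r : seq I) (f : I -> K) :
  normc (\sum_(i <- r) f i) <= \sum_(i <- r) normc (f i).
Proof.
elim: r => [|i r IH]; first by rewrite !big_nil normc0.
by rewrite !big_cons (le_trans (normcD _ _)) // lerD2l.
Qed.

(** The coordinate x i is the A-product of A^-1 e_i with x, so that
    Cauchy-Schwarz bounds it by the form at x. *)
Lemma qform_coercive p (A : 'M[K]_p) : herm_pos A ->
  exists2 c : R, 0 < c & forall x : 'cV[K]_p, c * \sum_i normc (x i 0) ^+ 2 <= qform A x.
Proof.
move=> pA; have [hA _] := pA; have uA := posdefmx_unit pA.2.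
pose y i : 'cV[K]_p := invmx A *m delta_mx i 0.
have yE i x : form A (y i) x = x i 0.
  rewrite /form adjM adj_inv hA -mulmxA -mulmxA mulKmx //.
  rewrite (_ : (delta_mx i 0)^t* = delta_mx 0 i) -?rowE ?mxE //.
  by apply/matrixP => k l; rewrite !mxE andbC rmorph_nat.
pose c := \sum_i qform A (y i) + 1.
have c0 : 0 < c by rewrite ltr_wpDl // sumr_ge0 // => i _; exact: qform_ge0.
exists c^-1 => [|x]; first by rewrite invr_gt0.
rewrite mulrC ler_pdivrMr //.
apply: (@le_trans _ _ (\sum_i qform A (y i) * qform A x)).
  by apply: ler_sum => i _; rewrite -yE; exact: cauchy_schwarz.
by rewrite -mulr_suml mulrC ler_wpM2l ?qform_ge0 // lerDl.
Qed.

Lemma qform_bound p (E : 'M[K]_p) (e : R) (x : 'cV[K]_p) : 0 <= e ->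
  (forall i j, normc (E i j) <= e) ->
  `|qform E x| <= e * p%:R * \sum_i normc (x i 0) ^+ 2.
Proof.
move=> e0 Ee; apply: le_trans (ler_normcRe _) _.
rewrite /form mxE; apply: le_trans (normc_sum _ _) _.
apply: (@le_trans _ _ (\sum_j \sum_i e * ((normc (x i 0) ^+ 2 + normc (x j 0) ^+ 2) / 2))).
  apply: ler_sum => j _; rewrite normcM mxE.
  apply: (@le_trans _ _ ((\sum_i normc (x i 0) * e) * normc (x j 0))).
    rewrite ler_wpM2r ?normc_ge0 //; apply: le_trans (normc_sum _ _) _.
    by apply: ler_sum => i _; rewrite normcM !mxE normcJ ler_wpM2l ?normc_ge0.
  rewrite mulr_suml; apply: ler_sum => i _.
  rewrite mulrAC mulrC ler_wpM2l //.
  have : 0 <= (normc (x i 0) - normc (x j 0)) ^+ 2 by exact: sqr_ge0.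
  by lra.
under eq_bigr do rewrite -mulr_sumr.
rewrite -mulr_sumr -mulrA ler_wpM2l //.
under eq_bigr do rewrite -mulr_suml big_split /= sumr_const card_ord.
rewrite -mulr_suml big_split /= sumr_const card_ord sumrMnl.
by move: (\sum_i _) => s; rewrite -(mulr_natl s p); lra.
Qed.

Lemma continuous_bigsum (I : Type) (r : seq I) (f : I -> C -> C) (t : C) :
  (forall i, {for t, continuous (f i)}) ->
  {for t, continuous (fun x => \sum_(i <- r) f i x : C)}.
Proof.
move=> cf; elim: r => [|i r IH].
  rewrite (_ : (fun _ => _) = fun=> 0); first exact: cst_continuous.
  by apply/funext => x; rewrite big_nil.
rewrite (_ : (fun _ => _) = fun x => f i x + \sum_(i <- r) f i x).
  exact: (continuousD (cf i) IH).
by apply/funext => x; rewrite big_cons.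
Qed.

Lemma continuous_conj (f : C -> C) (t : C) : {for t, continuous f} ->
  {for t, continuous (fun x => (f x)^* : C)}.
Proof.
move=> /continuous_normcP cf; apply/continuous_normcP => e e0.
have [d d0 dP] := cf e e0; exists d => // w /dP.
by rewrite -normcJ rmorphB.
Qed.

Lemma near_forall_ord p (X : 'I_p -> set C) (t : C) :
  (forall i, nbhs t (X i)) -> nbhs t [set w | forall i, X i w].
Proof. by move=> hX; exact: (@filter_forall _ _ X (nbhs t) _ hX). Qed.

Lemma pos_perturb (u v k l : R) : 0 < u -> k <= u -> - v <= l -> l <= k / 2 -> 0 < u + v.
Proof. lra. Qed.

(** The ball is open: by coercivity, positivity of P - z S z^* persists under
    small changes of its entries. *)
Lemma gball_near p q (P : 'M[K]_p) (S : 'M[K]_q) (G : C -> 'M[K]_(p, q)) (t : C) :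
  herm_pos P -> herm_pos S -> (forall i j, {for t, continuous (fun w => G w i j : C)}) ->
  gball P S (G t) -> nbhs t [set w | gball P S (G w)].
Proof.
move=> pP pS cG Gt; have [hP _] := pP; have [hS _] := pS.
pose A w := P - G w *m S *m (G w)^t*.
have hA w : (A w)^t* = A w by exact: gball_herm.
have cA i j : {for t, continuous (fun w => A w i j : C)}.
  rewrite (_ : (fun w => _) = fun w => P i j -
      \sum_k (\sum_l G w i l * S l k) * (G w j k)^*); last first.
    apply/funext => w; rewrite !mxE; congr (_ - _).
    by apply: eq_bigr => k _; rewrite !mxE.
  apply: continuous_sub; first exact: cst_continuous.
  apply: continuous_bigsum => k; apply: continuous_mul.
    apply: continuous_bigsum => l.
    by apply: continuous_mul; [exact: cG|exact: cst_continuous].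
  by apply: continuous_conj; exact: cG.
have [c c0 cP] := qform_coercive (conj (hA t) Gt).
pose e := c / (2 * p%:R + 1).
have den0 : 0 < 2 * p%:R + 1 :> R by rewrite ltr_wpDl // mulr_ge0.
have e0 : 0 < e by rewrite divr_gt0.
have : nbhs t [set w | forall i j, normc (A w i j - A t i j) < e].
  apply: near_forall_ord => i; apply: near_forall_ord => j.
  by have /continuous_normcP/(_ e e0)/nbhs_normcP := cA i j.
apply: filterS => w wA; apply/(posdefmxP (hA w)) => x x0.
have -> : A w = A t + (A w - A t) by rewrite addrC subrK.
rewrite qformD.
have := @qform_bound _ (A w - A t) e x (ltW e0).
have wA' i j : normc ((A w - A t) i j) <= e by have := wA i j; rewrite !mxE; exact: ltW.
move=> /(_ wA') /ler_normlP[] + _.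
have := cP x; have := qform_gt0 (conj (hA t) Gt) x0.
set s := \sum_i _ => q0 cs h.
have s0 : 0 <= s by apply: sumr_ge0 => i _; exact: sqr_ge0.
have ep : e * p%:R * s <= c / 2 * s.
  apply: ler_wpM2r => //; rewrite /e mulrAC ler_pdivrMr //.
  by rewrite mulrDr mulr1 mulrA divfK ?pnatr_eq0 // lerDl divr_ge0 // ltW.
by apply: (pos_perturb q0 cs h); rewrite [c * s / 2]mulrAC.
Qed.

End matrix_maps.

Local Opaque derivable.

(** * The Schwarz lemma for matrix balls *)

Section schwarz_matrix.
Context {R : realType}.
Local Notation K := R[i].
Local Notation C := R[i]^o.

Lemma derivable_subm p q (A B : C -> 'M[K]_(p, q)) (t : C) :
  derivable (A : C -> mxspace R p q) t 1 -> derivable (B : C -> mxspace R p q) t 1 ->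
  derivable (fun x => A x - B x : mxspace R p q) t 1.
Proof. by move=> dA dB; exact: (derivableB dA dB). Qed.

Lemma derivable_addm p q (A B : C -> 'M[K]_(p, q)) (t : C) :
  derivable (A : C -> mxspace R p q) t 1 -> derivable (B : C -> mxspace R p q) t 1 ->
  derivable (fun x => A x + B x : mxspace R p q) t 1.
Proof. by move=> dA dB; exact: (derivableD dA dB). Qed.

Lemma derivable_cstm p q (A : 'M[K]_(p, q)) (t : C) :
  derivable (fun _ : C => A : mxspace R p q) t 1.
Proof. exact: derivable_cst. Qed.

Section fixed_ball.
Variables (p q : nat) (P : 'M[K]_p) (S : 'M[K]_q).
Hypotheses (pP : herm_pos P) (pS : herm_pos S).
Implicit Types (F G : C -> 'M[K]_(p, q)) (x : 'cV[K]_p) (y : 'cV[K]_q).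

(** The functionals of gball_form, normalised so that the ball is where all of
    them have modulus less than 1. *)
Definition ell x y (z : 'M[K]_(p, q)) : C :=
  (Num.sqrt (qform P x * qform S y))^-1%:C * form (z *m S) x y.

Lemma gball_ell z : gball P S z <-> forall x y, x != 0 -> y != 0 -> normc (ell x y z) < 1.
Proof.
have E x y : x != 0 -> y != 0 -> (normc (ell x y z) < 1) =
    (normc (form (z *m S) x y) ^+ 2 < qform P x * qform S y).
  move=> x0 y0; have X0 : 0 < qform P x * qform S y by rewrite mulr_gt0 // qform_gt0.
  have s0 : 0 < Num.sqrt (qform P x * qform S y) by rewrite sqrtr_gt0.
  rewrite /ell normcM normc_real gtr0_norm ?invr_gt0 // mulrC ltr_pdivrMr // mul1r.
  rewrite -[in RHS](sqr_sqrtr (ltW X0)) ltr_pXn2r ?nnegrE ?normc_ge0 ?sqrtr_ge0 //.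
rewrite gball_form //; split=> h x y x0 y0; first by rewrite E //; exact: h.
by rewrite -E //; exact: h.
Qed.

Lemma ellZ x y c z : ell x y (c *: z) = c * ell x y z.
Proof. by rewrite /ell -scalemxAl formZ mulrCA. Qed.

Lemma derivable_ell x y F (t : C) : derivable (F : C -> mxspace R p q) t 1 ->
  derivable (fun w => ell x y (F w)) t 1.
Proof.
move=> dF; apply: derivable_mul; first exact: derivable_const.
have cx : derivable (fun _ : C => x^t* : mxspace R 1 p) t 1 by exact: derivable_cstm.
have cS : derivable (fun _ : C => S : mxspace R q q) t 1 by exact: derivable_cstm.
have cy : derivable (fun _ : C => y : mxspace R q 1) t 1 by exact: derivable_cstm.
by have /derivable_mx := derivable_mulmx (derivable_mulmx cx (derivable_mulmx dF cS)) cy;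
  exact.
Qed.

End fixed_ball.

Definition vschur p q (a : C) (F : C -> 'M[K]_(p, q)) (z : C) : 'M[K]_(p, q) :=
  \matrix_(i, j) schur a (fun w => F w i j) z.

Lemma vschurE p q a (F : C -> 'M[K]_(p, q)) z : 1 - a^* * z != 0 -> F a = 0 ->
  F z = blaschke a z *: vschur a F z.
Proof.
move=> d0 Fa; apply/matrixP => i j; rewrite !mxE.
by rewrite (schurE (F := fun w => F w i j) d0) // Fa mxE.
Qed.

Lemma derivable_vschur p q a (F : C -> 'M[K]_(p, q)) (r : R) z : 0 < r ->
  (forall w, normc (w - a) < r -> derivable (F : C -> mxspace R p q) w 1) ->
  derivable (F : C -> mxspace R p q) z 1 ->
  derivable (vschur a F : C -> mxspace R p q) z 1.
Proof.
move=> r0 dF dz; apply/derivable_mx => i j.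
rewrite (_ : (fun w => _) = schur a (fun w => F w i j)); last first.
  by apply/funext => w; rewrite mxE.
apply: (derivable_schur r0); last by move/derivable_mx : dz.
by move=> w /dF /derivable_mx.
Qed.

Lemma continuous_eq_off (f g : C -> C) (a : C) : {for a, continuous f} ->
  {for a, continuous g} -> (forall w, w != a -> normc w < 1 -> f w = g w) ->
  normc a < 1 -> f a = g a.
Proof.
move=> cf cg fg a1; apply/eqP; rewrite -subr_eq0 -normc_eq0 eq_le normc_ge0 andbT.
apply/ler_addgt0Pr => e e0; rewrite add0r.
have e20 : 0 < e / 2 by rewrite divr_gt0.
have [d1 d10 fd] := (continuous_normcP f a).1 cf _ e20.
have [d2 d20 gd] := (continuous_normcP g a).1 cg _ e20.
have a10 : 0 < 1 - normc a by rewrite subr_gt0.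
pose m := Num.min d1 (Num.min d2 (1 - normc a)).
have m0 : 0 < m by rewrite !lt_min d10 d20.
pose t := m / 2; have t0 : 0 < t by rewrite divr_gt0.
have : t < m by rewrite /t; lra.
rewrite /m !lt_min => /and3P[t1 t2 t3].
pose w : C := a + t%:C.
have wa : normc (w - a) = t by rewrite /w addrC addKr normc_real gtr0_norm.
have w1 : normc w < 1 by have := normc_triB w a; rewrite wa; lra.
have wa0 : w != a by rewrite -subr_eq0 -normc_gt0 wa.
have := fd w; have := gd w; rewrite wa (fg w wa0 w1) => /(_ t2) h1 /(_ t1) h2.
rewrite (_ : f a - g a = (g w - g a) - (g w - f a)); last by ring.
by apply: le_trans (normcB _ _) _; lra.
Qed.

Section schwarz_ball.
Variables (p q : nat) (P : 'M[K]_p) (S : 'M[K]_q) (a : C).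
Hypotheses (pP : herm_pos P) (pS : herm_pos S) (a1 : normc a < 1).
Variable F : C -> 'M[K]_(p, q).
Hypotheses (dF : forall z, normc z < 1 -> derivable (F : C -> mxspace R p q) z 1)
  (F_in : forall z, normc z < 1 -> gball P S (F z)) (Fa : F a = 0).

Lemma derivable_vschur_disc z : normc z < 1 ->
  derivable (vschur a F : C -> mxspace R p q) z 1.
Proof.
have [r r0 rP] := disc_nbhd a1; move=> z1; apply: (derivable_vschur r0); last exact: dF.
by move=> w /rP; exact: dF.
Qed.

(** Linear functionals commute with the Schur quotient: off a by division, at
    a by continuity. *)
Lemma ell_vschur x y z : normc z < 1 ->
  ell P S x y (vschur a F z) = schur a (fun w => ell P S x y (F w)) z.
Proof.
have ellF0 : ell P S x y (F a) = 0 by rewrite Fa -(scale0r (0 : 'M[K]_(p, q))) ellZ mul0r.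
have off w : w != a -> normc w < 1 ->
    ell P S x y (vschur a F w) = schur a (fun w => ell P S x y (F w)) w.
  move=> wa w1; have d0 := blaschke_denom_neq0 (ltW w1) a1.
  have b0 : blaschke a w != 0 by rewrite mulf_neq0 ?invr_neq0 // subr_eq0.
  apply: (mulfI b0); rewrite -ellZ -vschurE //.
  by rewrite -(schurE (F := fun w => ell P S x y (F w)) d0).
move=> z1; have [->|za] := eqVneq z a; last exact: off.
have [r r0 rP] := disc_nbhd a1.
apply: (continuous_eq_off (f := fun w => ell P S x y (vschur a F w))
  (g := schur a (fun v => ell P S x y (F v))) _ _ off a1).
  apply: derivable_continuous; apply: derivable_ell; exact: derivable_vschur_disc.
apply: derivable_continuous; apply: (derivable_schur r0).
  by move=> w /rP w1; apply: derivable_ell; exact: dF.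
by apply: derivable_ell; exact: dF.
Qed.

Lemma ell_vschur_le1 x y z : x != 0 -> y != 0 -> normc z < 1 ->
  normc (ell P S x y (vschur a F z)) <= 1.
Proof.
move=> x0 y0 z1; rewrite ell_vschur //.
apply: (schur_le1 (F := fun w => ell P S x y (F w))) => //.
- by rewrite Fa -(scale0r (0 : 'M[K]_(p, q))) ellZ mul0r.
- by move=> w w1; apply: derivable_ell; exact: dF.
- by move=> w w1; apply/ltW/(gball_ell pP pS _).1 => //; exact: F_in.
Qed.

(** If the quotient is outside the ball at one point of the disc, one of the
    functionals has modulus 1 there, and it has modulus 1 on the disc by the
    strong maximum principle. *)
Lemma vschur_dichotomy : (forall z, normc z < 1 -> gball P S (vschur a F z)) \/
  exists x y, [/\ x != 0, y != 0 &
    forall z, normc z < 1 -> normc (ell P S x y (vschur a F z)) = 1].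
Proof.
have [h|/existsNP[z0 /not_implyP[z01]]] :=
  pselect (forall z, normc z < 1 -> gball P S (vschur a F z)).
  by left.
move=> nb; right; move: nb; rewrite gball_ell // => /existsNP[x /existsNP[y]].
move=> /not_implyP[x0 /not_implyP[y0 /negP]]; rewrite -leNgt => ge1.
exists x, y; split=> // z z1.
rewrite (strong_max (q := fun w => ell P S x y (vschur a F w)) z01 _ _ _ z1).
- by apply/eqP; rewrite eq_le ge1 andbT; exact: ell_vschur_le1.
- by move=> w w1; apply: derivable_ell; exact: derivable_vschur_disc.
- by move=> w w1; exact: ell_vschur_le1.
- by apply/eqP; rewrite eq_le ge1 andbT; exact: ell_vschur_le1.
Qed.

End schwarz_ball.

End schwarz_matrix.

(** * Solutions near the closed disc *)

Section reduction.
Context {R : realType}.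
Local Notation K := R[i].
Local Notation C := R[i]^o.

(** The data x |-> f x, x in s, are extremal when this fails. *)
Definition interpolable (V : normedModType K) (D : set V) (f : C -> V) (s : seq C) :=
  exists (U : set C) (g : C -> V), [/\ open U, closed_disc `<=` U, holomorphic_map U D g
    & forall x, x \in s -> g x = f x].

Lemma interpolable_sub (V : normedModType K) (D : set V) (f : C -> V) (s t : seq C) :
  {subset s <= t} -> interpolable D f t -> interpolable D f s.
Proof. by move=> st [U [g [oU cU hg gf]]]; exists U, g; split=> // x /st /gf. Qed.

Section nbhd.
Variables (p q : nat) (P : 'M[K]_p) (S : 'M[K]_q) (a : C).
Hypotheses (pP : herm_pos P) (pS : herm_pos S) (a1 : normc a < 1).

(** On the circle the Blaschke factor has modulus 1, so the quotient is in the
    ball with F. On the disc, the second alternative of vschur_dichotomy is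
    excluded: the functional of modulus 1 on the disc would have modulus less
    than 1 at the boundary point 1, against continuity. *)
Lemma vschur_closed_disc (U : set C) (F : C -> 'M[K]_(p, q)) :
  open U -> closed_disc `<=` U ->
  (forall z, U z -> derivable (F : C -> mxspace R p q) z 1) ->
  (forall z, U z -> gball P S (F z)) -> F a = 0 ->
  forall z, normc z <= 1 -> gball P S (vschur a F z).
Proof.
move=> oU cU dF F_in Fa.
have U1 z : normc z <= 1 -> U z by move=> z1; apply: cU; rewrite closed_discE.
have [r r0 rP] := disc_nbhd a1.
have dV z : normc z <= 1 -> derivable (vschur a F : C -> mxspace R p q) z 1.
  move=> z1; apply: (derivable_vschur r0); last by apply: dF; exact: U1.
  by move=> w /rP w1; apply: dF; apply: U1; exact: ltW.
have circle z x y : normc z = 1 -> x != 0 -> y != 0 ->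
    normc (ell P S x y (vschur a F z)) < 1.
  move=> z1 x0 y0; have z1' : normc z <= 1 by rewrite z1.
  have d0 := blaschke_denom_neq0 z1' a1.
  have := (gball_ell pP pS (F z)).1 (F_in z (U1 z z1')) x y x0 y0.
  by rewrite {1}(vschurE d0 Fa) ellZ normcM blaschke_circle // mul1r.
have dF1 z : normc z < 1 -> derivable (F : C -> mxspace R p q) z 1.
  by move=> z1; apply: dF; apply: U1; exact: ltW.
have F1 z : normc z < 1 -> gball P S (F z).
  by move=> z1; apply: F_in; apply: U1; exact: ltW.
have [inner|[x [y [x0 y0 one]]]] := vschur_dichotomy pP pS a1 dF1 F1 Fa.
  move=> z; rewrite le_eqVlt => /orP[/eqP z1|]; last exact: inner.
  by apply/(gball_ell pP pS) => x y; exact: circle.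
have n1 : normc (1 : C) = 1 by exact: normc1.
have : {for (1 : C), continuous (fun w => ell P S x y (vschur a F w))}.
  by apply: derivable_continuous; apply: derivable_ell; apply: dV; rewrite n1.
have [gap gapE] : exists gap, gap = 1 - normc (ell P S x y (vschur a F 1)) by eexists.
have gap0 : 0 < gap by rewrite gapE subr_gt0; exact: circle.
move=> /continuous_normcP/(_ _ gap0)[d d0 dP].
pose t := Num.min 1 d / 2.
have m0 : 0 < Num.min 1 d by rewrite lt_min ltr01.
have t0 : 0 < t by rewrite divr_gt0.
have : t < Num.min 1 d by rewrite /t; lra.
rewrite lt_min => /andP[t1 td].
have [w wE] : exists w : C, w = 1 - t%:C by eexists.
have w1 : normc w < 1.
  have -> : w = (1 - t)%:C by rewrite wE rmorphB rmorph1.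
  by rewrite normc_real ger0_norm; lra.
have wd : normc (w - 1) < d.
  by rewrite wE addrC addKr normc_opp normc_real gtr0_norm.
have := one w w1; have := dP w wd; move: gapE.
move: (ell P S x y (vschur a F w)) (ell P S x y (vschur a F 1)) => u v -> h u1.
by have := normc_triB u v; rewrite u1 => /le_lt_trans/(_ h); rewrite ltxx.
Qed.

End nbhd.

Lemma derivable_moeb p q (P : 'M[K]_p) (S : 'M[K]_q) (a0 : 'M[K]_(p, q))
    (f : C -> 'M[K]_(p, q)) (t : C) :
  herm_pos P -> herm_pos S -> gball P S a0 -> gball P S (f t) ->
  derivable (f : C -> mxspace R p q) t 1 ->
  derivable (fun w => moeb P S a0 (f w) : mxspace R p q) t 1.
Proof.
move=> pP pS a_in ft df.
have dsub : derivable (fun w => f w - a0 : mxspace R p q) t 1.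
  by apply: derivable_subm; [exact: df|exact: derivable_cstm].
apply: derivable_mulmx; last exact: dsub.
apply: (derivable_adjinv (A := fun w => moebN P S a0 (f w))).
  exact: (moebN_unit pP pS a_in ft).
apply: derivable_subm; first exact: derivable_cstm.
apply: derivable_mulmx; last exact: derivable_cstm.
by apply: derivable_mulmx; [exact: dsub|exact: derivable_cstm].
Qed.

Lemma derivable_moebV p q (P : 'M[K]_p) (S : 'M[K]_q) (a0 : 'M[K]_(p, q))
    (f : C -> 'M[K]_(p, q)) (t : C) :
  herm_pos P -> herm_pos S -> gball P S a0 ->
  gball (moebG P S a0) (moebH P S a0) (f t) ->
  derivable (f : C -> mxspace R p q) t 1 ->
  derivable (fun w => moebV P S a0 (f w) : mxspace R p q) t 1.
Proof.
move=> pP pS a_in ft df.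
apply: derivable_addm; first exact: derivable_cstm.
apply: derivable_mulmx; last exact: df.
apply: derivable_mulmx; first exact: derivable_cstm.
apply: (derivable_adjinv (A := fun w => moebM S a0 (f w))).
  exact: (moebM_unit pP pS a_in ft).
apply: derivable_addm; first exact: derivable_cstm.
apply: derivable_mulmx; last exact: derivable_cstm.
by apply: derivable_mulmx; [exact: df|exact: derivable_cstm].
Qed.

Definition holo_disc p q (P : 'M[K]_p) (S : 'M[K]_q) (f : C -> 'M[K]_(p, q)) :=
  (forall z, normc z < 1 -> derivable (f : C -> mxspace R p q) z 1) /\
  (forall z, normc z < 1 -> gball P S (f z)).

Definition ball_interpolable p q (P : 'M[K]_p) (S : 'M[K]_q) (f : C -> 'M[K]_(p, q)) s :=
  @interpolable (mxspace R p q) (gball P S) f s.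

(** Since the ball is open, a map that sends the closed disc into it still
    does so on a neighbourhood. *)
Lemma ball_interpolable_near p q (P : 'M[K]_p) (S : 'M[K]_q) (f g : C -> 'M[K]_(p, q)) s
    (U : set C) :
  open U -> herm_pos P -> herm_pos S ->
  (forall z, normc z <= 1 -> U z /\ gball P S (g z)) ->
  (forall z, U z -> derivable (g : C -> mxspace R p q) z 1) ->
  (forall x, x \in s -> g x = f x) ->
  ball_interpolable P S f s.
Proof.
move=> oU pP pS g_in dg gf; exists (U `&` [set z | gball P S (g z)])°, g.
have int_sub : (U `&` [set z | gball P S (g z)])° `<=` U `&` [set z | gball P S (g z)].
  exact: interior_subset.
split=> //; first exact: open_interior.
  move=> z; rewrite closed_discE => z1; have [Uz gz] := g_in z z1.
  apply: filterI; first exact: open_nbhs_nbhs.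
  apply: gball_near => // i j; apply: derivable_continuous.
  by have /derivable_mx := dg z Uz.
by split=> [z /int_sub[/dg]|z /int_sub[]].
Qed.

End reduction.

(** * Schur's algorithm and the choice of the nodes *)

Section transfer.
Context {R : realType}.
Local Notation K := R[i].
Local Notation C := R[i]^o.

Lemma near_neq0 (f : C -> C) (z : C) : {for z, continuous f} -> f z != 0 ->
  nbhs z [set w | f w != 0].
Proof.
move=> /continuous_normcP cf fz; have nz : 0 < normc (f z) by rewrite normc_gt0.
have [d d0 dP] := cf _ nz; apply/nbhs_normcP; exists d => // w /dP.
by apply: contraTneq => ->; rewrite sub0r normc_opp ltxx.
Qed.

Lemma gballZ p q (P : 'M[K]_p) (S : 'M[K]_q) (c : K) (z : 'M[K]_(p, q)) :
  herm_pos P -> herm_pos S -> normc c <= 1 -> gball P S z -> gball P S (c *: z).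
Proof.
move=> pP pS c1 z_in; apply/(gball_ell pP pS) => x y x0 y0.
rewrite ellZ normcM; apply: le_lt_trans ((gball_ell pP pS z).1 z_in x y x0 y0).
by rewrite ler_piMl ?normc_ge0.
Qed.

Lemma eq_vschur p q a (F G : C -> 'M[K]_(p, q)) (z : C) : z != a ->
  G z = F z -> G a = F a -> vschur a G z = vschur a F z.
Proof.
by move=> za Gz Ga; apply/matrixP => i j; rewrite !mxE /schur !dquotE // Gz Ga.
Qed.

Local Opaque gball ell vschur moeb moebV.

Lemma open_disc_sub (U : set C) (z : C) : closed_disc `<=` U -> normc z <= 1 -> U z.
Proof. by move=> cU z1; apply: cU; rewrite closed_discE. Qed.

Section step.
Variables (p q : nat) (P : 'M[K]_p) (S : 'M[K]_q) (f : C -> 'M[K]_(p, q)) (a : C).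
Hypotheses (pP : herm_pos P) (pS : herm_pos S) (hf : holo_disc P S f) (a1 : normc a < 1).

Let a_in : gball P S (f a). Proof. exact: hf.2. Qed.
Let G := moebG P S (f a).
Let H := moebH P S (f a).
Let pG : herm_pos G. Proof. exact: (moebG_pos pP pS a_in). Qed.
Let pH : herm_pos H. Proof. exact: (moebH_pos pP pS a_in). Qed.
Let F (g : C -> 'M[K]_(p, q)) (w : C) := moeb P S (f a) (g w).

(** Turns a solution for f with a among the nodes into one for the Schur
    quotient. *)
Lemma schur_descent (U : set C) (g : C -> 'M[K]_(p, q)) :
  open U -> closed_disc `<=` U ->
  (forall z, U z -> derivable (g : C -> mxspace R p q) z 1) ->
  (forall z, U z -> gball P S (g z)) -> g a = f a ->
  (forall z, U z -> derivable (vschur a (F g) : C -> mxspace R p q) z 1) /\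
  (forall z, normc z <= 1 -> gball G H (vschur a (F g) z)).
Proof.
move=> oU cU dg g_in ga.
have dF z : U z -> derivable (F g : C -> mxspace R p q) z 1.
  by move=> Uz; apply: (derivable_moeb pP pS a_in); [exact: g_in|exact: dg].
have F_in z : U z -> gball G H (F g z).
  by move=> Uz; apply: (moeb_in pP pS a_in); exact: g_in.
have Fa : F g a = 0 by rewrite /F ga moeb0.
split; last exact: (vschur_closed_disc pG pH a1 oU cU dF F_in Fa).
move=> z Uz; have [r r0 rP] := disc_nbhd a1.
apply: (derivable_vschur r0); last exact: dF.
by move=> w /rP w1; apply: dF; apply: (open_disc_sub cU); exact: ltW.
Qed.

(** The converse: multiply by the Blaschke factor and undo the Moebius map.
    Outside the closed disc the Blaschke factor exceeds 1 in modulus, which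
    the openness of the ball makes up for. *)
Lemma schur_ascent (U : set C) (g1 : C -> 'M[K]_(p, q)) (s : seq C) :
  (forall x, x \in s -> normc x < 1) ->
  open U -> closed_disc `<=` U ->
  (forall z, U z -> derivable (g1 : C -> mxspace R p q) z 1) ->
  (forall z, U z -> gball G H (g1 z)) ->
  (forall x, x \in s -> g1 x = vschur a (F f) x) ->
  ball_interpolable P S f (a :: s).
Proof.
move=> s1 oU cU dg1 g1_in g1f.
pose h w := blaschke a w *: g1 w.
pose X := [set w : C | [/\ U w, 1 - a^* * w != 0 & gball G H (h w)]].
have X_sub : X° `<=` X by exact: interior_subset.
have dh z : U z -> 1 - a^* * z != 0 -> derivable (h : C -> mxspace R p q) z 1.
  move=> Uz dz; apply/derivable_mx => i j.
  rewrite (_ : (fun w => _) = fun w => blaschke a w * g1 w i j); last first.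
    by apply/funext => w; rewrite mxE.
  apply: derivable_mul; first exact: derivable_blaschke.
  by have /derivable_mx := dg1 z Uz.
exists (X°), (fun w => moebV P S (f a) (h w)); split.
- exact: open_interior.
- move=> z; rewrite closed_discE => z1.
  have Uz := open_disc_sub cU z1; have dz := blaschke_denom_neq0 z1 a1.
  have n1 : nbhs z U by apply: open_nbhs_nbhs.
  have n2 : nbhs z [set w : C | 1 - a^* * w != 0].
    apply: (near_neq0 (f := fun w => 1 - a^* * w) _ dz); apply: derivable_continuous.
    exact: derivable_blaschke_denom.
  have n3 : nbhs z [set w | gball G H (h w)].
    apply: (gball_near pG pH) => [i j|].
      by apply: derivable_continuous; have /derivable_mx := dh z Uz dz.
    by apply: (gballZ pG pH); [exact: blaschke_le1|exact: g1_in].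
  by rewrite /interior; near=> w; split; near: w.
- split=> [z /X_sub[Uz dz hz]|z /X_sub[Uz dz hz]].
    by apply: (derivable_moebV pP pS a_in hz); exact: dh.
  exact: (moebV_in pP pS a_in).
- move=> x; rewrite inE => /orP[/eqP ->|xs].
    by rewrite /h /blaschke subrr mul0r scale0r moebV0.
  have x1 := s1 x xs; rewrite /h g1f //.
  rewrite -vschurE ?(blaschke_denom_neq0 (ltW x1) a1) //; last by rewrite /F moeb0.
  by apply: (moebK pP pS a_in); exact: hf.2.
Unshelve. all: by end_near. Qed.

(** One step of Schur's algorithm, for f followed by the Moebius map with base
    point f a. If the quotient misses the ball, a and any other node already
    are extremal nodes for f. Otherwise the quotient f1 is a map into a ball,
    and a :: s for f amounts to s for f1. *)
Lemma schur_step :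
  (forall mu, normc mu < 1 -> mu != a -> ~ ball_interpolable P S f [:: a; mu]) \/
  exists f1, holo_disc G H f1 /\
    forall s, a \notin s -> (forall x, x \in s -> normc x < 1) ->
    ball_interpolable P S f (a :: s) <-> ball_interpolable G H f1 s.
Proof.
have dF z : normc z < 1 -> derivable (F f : C -> mxspace R p q) z 1.
  by move=> z1; apply: (derivable_moeb pP pS a_in); [exact: hf.2|exact: hf.1].
have F_in z : normc z < 1 -> gball G H (F f z).
  by move=> z1; apply: (moeb_in pP pS a_in); exact: hf.2.
have Fa : F f a = 0 by rewrite /F moeb0.
have descent s : ball_interpolable P S f (a :: s) -> exists U g1,
  [/\ open U, closed_disc `<=` U,
    forall z, U z -> derivable (g1 : C -> mxspace R p q) z 1,
    forall z, normc z <= 1 -> gball G H (g1 z) &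
    forall x, x \in s -> x != a -> g1 x = vschur a (F f) x].
  move=> [U [g [oU cU [dg g_in] gf]]]; have ga : g a = f a by apply: gf; rewrite mem_head.
  have [dV V_in] := schur_descent oU cU dg g_in ga.
  exists U, (vschur a (F g)); split; [exact: oU|exact: cU|exact: dV|exact: V_in|].
  move=> x xs xa; apply: (eq_vschur xa).
    by rewrite /F gf // inE xs orbT.
  by rewrite /F ga.
have [inner|[x [y [x0 y0 one]]]] := vschur_dichotomy pG pH a1 dF F_in Fa; [right|left].
  exists (vschur a (F f)); split.
    by split; [move=> z z1; exact: (derivable_vschur_disc a1 dF)|exact: inner].
  move=> s sa s1; split.
    move=> /descent[U [g1 [oU cU dg1 g1_in g1f]]].
    apply: (ball_interpolable_near oU pG pH _ dg1) => [z z1|z zs].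
      by split; [exact: (open_disc_sub cU)|exact: g1_in].
    by apply: (g1f z zs); apply: contraNneq sa => <-.
  by move=> [U [g1 [oU cU [dg1 g1_in] g1f]]]; exact: (schur_ascent s1 oU cU dg1 g1_in g1f).
move=> mu mu1 mua /descent[U [g1 [_ _ _ g1_in g1f]]].
have := g1_in mu (ltW mu1); rewrite g1f ?mem_head //.
by move=> /(gball_ell pG pH)/(_ x y x0 y0); rewrite one // ltxx.
Qed.

End step.

Lemma interpolable_single (V : normedModType K) (D : set V) (f : C -> V) (x : C) :
  D (f x) -> interpolable D f [:: x].
Proof.
move=> Dx; exists setT, (fun=> f x); split => //; first exact: openT.
  by split=> // z _; exact: derivable_cst.
by move=> y; rewrite inE => /eqP ->.
Qed.

(** By induction on the number of nodes. Families that share a node b are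
    compared by schur_step at b and the induction hypothesis; this is pivot.
    The general case takes at most two pivots. A single node never is
    extremal, because of the constant maps. *)
Lemma ball_transfer n p q (P : 'M[K]_p) (S : 'M[K]_q) (f : C -> 'M[K]_(p, q))
    (s t : seq C) :
  herm_pos P -> herm_pos S -> holo_disc P S f ->
  size s = n -> size t = n -> uniq s -> uniq t ->
  (forall x, x \in s -> normc x < 1) -> (forall x, x \in t -> normc x < 1) ->
  ball_interpolable P S f t -> ball_interpolable P S f s.
Proof.
elim: n P S f s t => [|n IH] P S f s t pP pS hf.
  move=> /size0nil -> _ _ _ _ _; apply: interpolable_sub; exact: (mem_subseq (sub0seq _)).
case: s => [//|a s] [sn]; case: n IH sn => [|n] IH sn.
  move=> _ _ _ a1 _ _; move/size0nil : sn => ->.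
  by apply: interpolable_single; apply: hf.2; apply: a1; rewrite mem_head.
have pivot b u v : size u = n.+1 -> size v = n.+1 -> uniq (b :: u) -> uniq (b :: v) ->
    (forall x, x \in b :: u -> normc x < 1) -> (forall x, x \in b :: v -> normc x < 1) ->
    ball_interpolable P S f (b :: v) -> ball_interpolable P S f (b :: u).
  move=> un vn /= /andP[bu uu] /andP[bv uv] u1 v1.
  have b1 : normc b < 1 by apply: u1; rewrite mem_head.
  have u1' x : x \in u -> normc x < 1 by move=> xu; apply: u1; rewrite inE xu orbT.
  have v1' x : x \in v -> normc x < 1 by move=> xv; apply: v1; rewrite inE xv orbT.
  have b_in := hf.2 b b1.
  have [none|[f1 [hf1 f1P]]] := schur_step pP pS hf b1.
    case: v vn bv uv v1 v1' => [//|c v] _ bv _ _ v1' h; exfalso.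
    apply: (none c); first by apply: v1'; rewrite mem_head.
      by apply: contraNneq bv => ->; rewrite mem_head.
    by apply: interpolable_sub h => x; rewrite !inE => /orP[->//|->]; rewrite orbT.
  move=> /(f1P v bv v1') h; apply/(f1P u bu u1').
  exact: (IH _ _ _ _ _ (moebG_pos pP pS b_in) (moebH_pos pP pS b_in)
    hf1 un vn uu uv u1' v1' h).
case: t => [//|b t] [tn] us ut s1 t1 ht.
have [ab|ab] := boolP (a \in b :: t).
  apply: (pivot a s (rem a (b :: t))) => //.
  - by rewrite size_rem.
  - by rewrite cons_uniq mem_rem_uniqF // rem_uniq.
  - move=> x; rewrite inE => /orP[/eqP ->|/mem_rem]; last exact: t1.
    by apply: s1; rewrite mem_head.
  - apply: interpolable_sub ht => x; rewrite -(perm_mem (perm_to_rem ab)) //.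
case: t tn ut t1 ht ab => [//|c t] tn ut t1 ht; rewrite !inE !negb_or => /and3P[ab ac at_].
move: ut; rewrite /= !inE !negb_or => /andP[/andP[bc bt] /andP[ct ut]].
have a1 : normc a < 1 by apply: s1; rewrite mem_head.
have b1 : normc b < 1 by apply: t1; rewrite mem_head.
have c1 : normc c < 1 by apply: t1; rewrite !inE eqxx orbT.
have t1' x : x \in t -> normc x < 1 by move=> xt; apply: t1; rewrite !inE xt !orbT.
(* from a :: s to a :: c :: t, then from c :: a :: t to c :: b :: t *)
apply: (pivot a s (c :: t)) => //; first by rewrite /= !inE negb_or ac at_ ct.
  by move=> x; rewrite !inE => /or3P[/eqP ->|/eqP ->|/t1'].
apply: (interpolable_sub (t := c :: a :: t)).
  by move=> x; rewrite !inE orbCA.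
apply: (pivot c (a :: t) (b :: t)) => //.
- by rewrite /= !inE negb_or eq_sym ac ct at_.
- by rewrite /= !inE negb_or eq_sym bc ct bt.
- by move=> x; rewrite !inE => /or3P[/eqP ->|/eqP ->|/t1'].
- by move=> x; rewrite !inE => /or3P[/eqP ->|/eqP ->|/t1'].
- by apply: interpolable_sub ht => x; rewrite !inE orbCA.
Qed.

End transfer.

Local Transparent derivable gball ell vschur moeb moebV.

(** * The Cartan domains *)

Section cartan.
Context {R : realType}.
Local Notation K := R[i].
Local Notation C := R[i]^o.

Lemma matrix_ballE p q : @matrix_ball R p q = gball 1%:M 1%:M.
Proof. by apply/funext => z; rewrite /matrix_ball /gball /= mulmx1. Qed.

Lemma interpolableS (V : normedModType K) (D D' : set V) (f : C -> V) s :
  D `<=` D' -> interpolable D f s -> interpolable D' f s.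
Proof.
move=> DD' [U [g [oU cU [dg g_in] gf]]]; exists U, g; split=> //.
by split=> [//|z Uz]; apply: DD'; exact: g_in.
Qed.

(** Extremality of the data of a map depends only on the number of nodes. *)
Definition transferable (V : normedModType K) (D : set V) :=
  forall (f : C -> V) (s t : seq C), holomorphic_map disc D f ->
  size s = size t -> uniq s -> uniq t ->
  (forall x, x \in s -> normc x < 1) -> (forall x, x \in t -> normc x < 1) ->
  interpolable D f t -> interpolable D f s.

Lemma matrix_ball_transferable p q :
  transferable (matrix_ball : set (mxspace R p q)).
Proof.
move=> f s t [df f_in] st us ut s1 t1; rewrite matrix_ballE.
have hf : holo_disc 1%:M 1%:M f.
  split=> z z1; first by apply: df; rewrite discE.
  by rewrite -matrix_ballE; apply: f_in; rewrite discE.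
exact: (@ball_transfer R (size t) p q 1%:M 1%:M f s t (@herm_pos1 R p) (@herm_pos1 R q)
  hf st erefl us ut s1 t1).
Qed.

Lemma form_tr p q (z : 'M[K]_(p, q)) x y :
  form z^T x y = form z ((y^t*)^T) ((x^t*)^T).
Proof.
have trE (B : 'M[K]_1) : B 0 0 = B^T 0 0 by rewrite mxE.
have yE : ((y^t*)^T)^t* = y^T by apply/matrixP => i j; rewrite !mxE conjCK.
by rewrite /form trE trmx_mul [(x^t* *m z^T)^T]trmx_mul trmxK mulmxA yE.
Qed.

(** The conjugates of the vectors y and x serve for z^T where x and y serve
    for z. *)
Lemma gball1_tr p (z : 'M[K]_p) : gball 1%:M 1%:M z -> gball 1%:M 1%:M z^T.
Proof.
have p1 : herm_pos (1%:M : 'M[K]_p) by exact: herm_pos1.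
have q1 n (x : 'cV[K]_n) : qform 1%:M ((x^t*)^T) = qform 1%:M x :> R.
  by rewrite /qform -form_tr trmx1.
move=> /(gball_form z p1 p1) z_in; apply/(gball_form z^T p1 p1) => x y x0 y0.
rewrite mulmx1 form_tr mulrC -(q1 p x) -(q1 p y) -[z]mulmx1; apply: z_in.
  by rewrite trmx_eq0 adj_eq0.
by rewrite trmx_eq0 adj_eq0.
Qed.

Lemma gball_avg p (P S : 'M[K]_p) z w : herm_pos P -> herm_pos S ->
  gball P S z -> gball P S w -> gball P S (2^-1 *: (z + w)).
Proof.
move=> pP pS /(gball_ell pP pS) z_in /(gball_ell pP pS) w_in.
apply/(gball_ell pP pS) => x y x0 y0.
have -> : ell P S x y (2^-1 *: (z + w)) = (ell P S x y z + ell P S x y w) / 2.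
  by rewrite ellZ /ell mulmxDl formD mulrC mulrDr.
rewrite normc_half ltr_pdivrMr // mul1r; apply: le_lt_trans (normcD _ _) _.
by rewrite -[2]/(1 + 1); apply: ltrD; [exact: z_in|exact: w_in].
Qed.

(** If g solves symmetric (e = 1) or skew-symmetric (e = -1) data within the
    matrix ball, so does (g + e g^T) / 2 within the symmetric or
    skew-symmetric part, the ball being convex and stable under transposition.
    Extremal data for types II and III therefore are the same as for type I. *)
Lemma signed_transferable p (e : K) : e ^+ 2 = 1 -> normc e = 1 ->
  transferable ([set z | z^T = e *: z /\ matrix_ball z] : set (mxspace R p p)).
Proof.
move=> e2 ne f s t [df f_in] st us ut s1 t1 ht.
have [U [g [oU cU [dg g_in] gf]]] : interpolable (matrix_ball : set (mxspace R p p)) f s.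
  apply: matrix_ball_transferable st us ut s1 t1 _.
    by split=> [//|z /f_in[]].
  by apply: interpolableS ht => z [].
have p1 : herm_pos (1%:M : 'M[K]_p) by exact: herm_pos1.
pose h z : mxspace R p p := 2^-1 *: ((g z : 'M[K]_p) + e *: (g z)^T).
have he z : (h z : 'M[K]_p)^T = e *: (h z : 'M[K]_p).
  rewrite /h; move: (g z : 'M[K]_p) => A; apply/matrixP => i j; rewrite !mxE.
  by rewrite mulrCA [e * (_ + _)]mulrDr mulrA -expr2 e2 mul1r [_ + A j i]addrC.
have avg (A : 'M[K]_p) : A^T = e *: A -> 2^-1 *: (A + e *: A^T) = A.
  move=> ->; apply/matrixP => i j; rewrite !mxE mulrA -expr2 e2 mul1r.
  by field.
exists U, h; split; [exact: oU|exact: cU|split|].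
- move=> z Uz; have /derivable_mx dgz := dg z Uz; apply/derivable_mx => i j.
  rewrite (_ : (fun x => _) =
      fun x => 2^-1 * ((g x : 'M[K]_p) i j + e * (g x : 'M[K]_p) j i)).
    apply: derivable_mul; first exact: derivable_const.
    apply: derivable_add; first exact: dgz.
    by apply: derivable_mul; [exact: derivable_const|exact: dgz].
  by apply/funext => x; rewrite !mxE.
- move=> z Uz; split; first exact: he.
  have := g_in z Uz; rewrite matrix_ballE => gz.
  apply: (gball_avg p1 p1 gz); apply: (gballZ p1 p1); first by rewrite ne.
  exact: gball1_tr.
- move=> x xs; have fx : (f x : 'M[K]_p)^T = e *: (f x : 'M[K]_p).
    by apply: (f_in x _).1; rewrite discE; exact: s1.
  rewrite /h (gf x xs).
  exact: avg fx.
Qed.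

Lemma derivable_pair (V W : normedModType K) (f : C -> V) (g : C -> W) (z : C) :
  derivable f z 1 -> derivable g z 1 -> derivable (fun w => (f w, g w) : (V * W)%type) z 1.
Proof.
move=> /cvg_ex[/= l fl] /cvg_ex[/= k gk]; apply/cvg_ex; exists (l, k) => /=.
exact: (cvg_pair fl gk).
Qed.

Lemma derivable_fst (V W : normedModType K) (f : C -> (V * W)%type) (z : C) :
  derivable f z 1 -> derivable (fun w => (f w).1) z 1.
Proof.
move=> /cvg_ex[/= l fl]; apply/cvg_ex; exists l.1.
exact: (cvg_comp _ _ fl (cvg_fst)).
Qed.

Lemma derivable_snd (V W : normedModType K) (f : C -> (V * W)%type) (z : C) :
  derivable f z 1 -> derivable (fun w => (f w).2) z 1.
Proof.
move=> /cvg_ex[/= l fl]; apply/cvg_ex; exists l.2.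
exact: (cvg_comp _ _ fl (cvg_snd)).
Qed.

(** A solution in a product is a pair of solutions, and each of them can be
    moved to the new nodes separately. *)
Lemma prod_transferable (V W : normedModType K) (D : set V) (E : set W) :
  transferable D -> transferable E ->
  transferable (D `*` E : set (V * W)%type).
Proof.
move=> tD tE f s t [df f_in] st us ut s1 t1 [U [g [oU cU [dg g_in] gf]]].
have [U1 [g1 [oU1 cU1 [dg1 g1_in] g1f]]] : interpolable D (fun w => (f w).1) s.
  apply: tD st us ut s1 t1 _.
    by split=> [z /df /derivable_fst|z /f_in[]].
  exists U, (fun w => (g w).1); split=> //; last by move=> x /gf ->.
  by split=> [z /dg /derivable_fst|z /g_in[]].
have [U2 [g2 [oU2 cU2 [dg2 g2_in] g2f]]] : interpolable E (fun w => (f w).2) s.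
  apply: tE st us ut s1 t1 _.
    by split=> [z /df /derivable_snd|z /f_in[]].
  exists U, (fun w => (g w).2); split=> //; last by move=> x /gf ->.
  by split=> [z /dg /derivable_snd|z /g_in[]].
exists (U1 `&` U2), (fun w => (g1 w, g2 w)); split.
- exact: openI.
- by move=> z z1; split; [exact: cU1|exact: cU2].
- split=> z [U1z U2z]; first by apply: derivable_pair; [exact: dg1|exact: dg2].
  by split; [exact: g1_in|exact: g2_in].
- by move=> x xs; rewrite g1f // g2f //; case: (f x).
Qed.

Lemma cartan_transferable (s : cartan_shape) : transferable (@cartan_domain R s).
Proof.
elim: s => [p q|p|p|s1 IH1 s2 IH2] /=.
- exact: matrix_ball_transferable.
- have := @signed_transferable p 1 (expr1n _ _) (normc1 _).
  by under [X in transferable X]eq_set do rewrite scale1r.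
- have := @signed_transferable p (-1) _ _; rewrite sqrrN expr1n normc_opp normc1.
  move=> /(_ erefl erefl); by under [X in transferable X]eq_set do rewrite scaleN1r.
- exact: prod_transferable.
Qed.

End cartan.

Theorem proposition8 (R : realType) (s : cartan_shape) (hs : pos_sizes s)
    (m : nat) (hm : (2 <= m)%N) (f : R[i]^o -> cartan_space R s) :
  weak_m_extremal (@cartan_domain R s) m f ->
  m_extremal (@cartan_domain R s) m f.
Proof.
move=> [hf [lam [[lam_inj lam1] [_ ext]]]]; split=> // mu [mu_inj mu1].
split; first by exists f.
move=> [U [g [oU cU hg gf]]]; apply: ext.
pose nodes (l : 'I_m -> R[i]^o) := [seq l i | i <- enum 'I_m].
have nodesP (l : 'I_m -> R[i]^o) : injective l -> (forall j, disc (l j)) ->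
    [/\ size (nodes l) = m, uniq (nodes l) & forall x, x \in nodes l -> normc x < 1].
  move=> l_inj l1; split; first by rewrite size_map size_enum_ord.
    by rewrite map_inj_uniq // enum_uniq.
  by move=> _ /mapP[j _ ->]; rewrite -discE.
have [sl ul l1] := nodesP lam lam_inj lam1.
have [sm um m1] := nodesP mu mu_inj mu1.
have mu_int : interpolable (@cartan_domain R s) f (nodes mu).
  by exists U, g; split=> // _ /mapP[j _ ->].
have [V [h [oV cV hh hf']]] :=
  cartan_transferable hf (etrans sl (esym sm)) ul um l1 m1 mu_int.
exists V, h; split=> // j; apply: hf'.
by apply: map_f; rewrite mem_enum.
Qed.
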